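(* Let $k\ge 2$. For any bounded set $B\subset\mathcal{MP}_k$, there exists a spherical cone metric $g$ on $\mathbb{S}^2$ with cone angle parameters $\vec\beta=(\beta_1,\dots,\beta_k)\notin B$ such that $2\in\mathrm{spec}(\Delta_g)$. When $k\ge5$, $\vec\beta$ can be chosen to be in the interior of $\mathcal{MP}_k$.
   Context: A spherical cone metric with cone angle parameters $\vec\beta\in\mathbb{R}^k_+=(0,\infty)^k$ is a metric of Gauss curvature $1$ away from $k$ distinct points $p_1,\dots,p_k$, with a conic singularity of cone angle $2\pi\beta_j$ at $p_j$. $\Delta_g=-\mathrm{div}\nabla$ denotes the Friedrichs extension of the Laplacian of $g$. The Mondello–Panov region is $$\mathcal{MP}_k=\{\vec\beta\in\mathbb{R}^k_+:\ d_1(\vec\beta-\vec1,\mathbb{Z}^k_{\mathrm{odd}})\ge1\},\qquad \mathbb{Z}^k_{\mathrm{odd}}=\{\gamma\in\mathbb{Z}^k:\ \textstyle\sum_i\gamma_i\in2\mathbb{Z}+1\},$$ where $d_1$ is the $\ell^1$ distance on $\mathbb{R}^k$ and $\vec1=(1,\dots,1)$. *)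

(* Defs.v *)
From mathcomp Require Import all_boot all_order all_algebra.
From mathcomp Require Import all_classical all_reals all_analysis.
Set Implicit Arguments.
Unset Strict Implicit.
Unset Printing Implicit Defensive.
Import Order.TTheory GRing.Theory Num.Theory.
Import numFieldNormedType.Exports.
Local Open Scope classical_set_scope.
Local Open Scope ring_scope.

(* A real Hilbert space is given by a
   carrier H inside a vector space V and a semi-inner product ip on H; vectors
   at distance 0 are identified (H = square-integrable functions below). An
   unbounded operator is given by its graph, or by a map T and a domain D. *)
Section hilbert.
Context {R : realType} {V : lmodType R}.
Variables (H : set V) (ip : V -> V -> R).

Definition hnorm (f : V) : R := Num.sqrt (ip f f).

(* Graph of the adjoint of the operator T with domain D. *)
Definition adjoint (D : set V) (T : V -> V) (f h : V) : Prop :=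
  [/\ H f, H h & forall phi, D phi -> ip f (T phi) = ip h phi].

(* Domain of the closure of the quadratic form phi |-> <T phi, phi> on D. *)
Definition form_domain (D : set V) (T : V -> V) : set V :=
  [set f | H f /\ exists u : nat -> V,
    [/\ forall n, D (u n),
        hnorm (u n - f) @[n --> \oo] --> (0 : R) &
        forall e : R, 0 < e -> exists N : nat, forall m n : nat,
          (N <= m)%N -> (N <= n)%N -> ip (T (u m - u n)) (u m - u n) < e] ].

(* The Friedrichs extension of a nonnegative symmetric operator is the
   restriction of its adjoint to the domain of the closed form. *)
Definition friedrichs (D : set V) (T : V -> V) (f h : V) : Prop :=
  form_domain D T f /\ adjoint D T f h.

(* A - l is bijective with bounded inverse: the bound also gives injectivity.
   For a real l this agrees with the resolvent set of the complexification. *)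
Definition resolvent_set (A : V -> V -> Prop) : set R :=
  [set l | (forall h, H h ->
              exists f g, A f g /\ hnorm (g - l *: f - h) = 0) /\
           (exists C : R, forall f g, A f g ->
              hnorm f <= C * hnorm (g - l *: f)) ].

Definition spectrum (A : V -> V -> Prop) : set R := ~` resolvent_set A.

End hilbert.

Section plane.
Context {R : realType}.
Local Notation plane := (R * R)%type.

Definition sqn (z : plane) : R := z.1 ^+ 2 + z.2 ^+ 2.

(* The norm of the product type R * R in the library is the sup norm. *)
Definition enorm (z : plane) : R := Num.sqrt (sqn z).

Definition basis_vec (i : bool) : plane := if i then (0, 1) else (1, 0).

Definition partial (i : bool) (f : plane -> R) : plane -> R :=
  fun z => 'D_(basis_vec i) f z.

(* C^oo on U: all iterated partial derivatives are differentiable on U. *)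
Definition smooth_on (U : set plane) (f : plane -> R) : Prop :=
  forall (s : seq bool) (z : plane), U z ->
    differentiable (foldr partial f s) z.

Definition flat_laplacian (f : plane -> R) (z : plane) : R :=
  partial false (partial false f) z + partial true (partial true f) z.

End plane.

Notation leb2 R := (@lebesgue_measure R \x @lebesgue_measure R)%E.

(* The sphere S^2 as the Riemann sphere C \cup {oo}, C = R * R, None = oo. *)
Notation sphere R := (one_point_compactification (R * R)%type).

Section metric.
Context {R : realType}.
Local Notation plane := (R * R)%type.
Local Notation sphere := (sphere R).

(* The two standard holomorphic charts z |-> z and w |-> 1/w. *)
Definition chart (b : bool) (z : plane) : sphere :=
  if ~~ b then Some z
  else if z == 0 then None
  else Some (z.1 / sqn z, - z.2 / sqn z).

(* A conformal metric on the sphere is encoded by v, standing for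
   g = e^(2v) g_round, where g_round = (2 / (1 + |z|^2))^2 |dz|^2 in both
   charts. Hence g = e^(2u) |dz|^2 in the chart b, with u = conf_exp v b. The
   values of v at the cone points are irrelevant. *)
Definition conf_exp (v : sphere -> R) (b : bool) (z : plane) : R :=
  v (chart b z) + ln (2 / (1 + sqn z)).

Definition gauss_curvature (v : sphere -> R) (b : bool) (z : plane) : R :=
  - expR (- 2 * conf_exp v b z) * flat_laplacian (conf_exp v b) z.

Definition smooth_sphere (U : set sphere) (f : sphere -> R) : Prop :=
  forall b, smooth_on (chart b @^-1` U) (f \o chart b).

(* Cone angle 2 pi beta at q: in a holomorphic coordinate centered at z0,
   g = e^(2w) |z - z0|^(2 (beta - 1)) |dz|^2 with w continuous up to z0. *)
Definition conic_at (v : sphere -> R) (q : sphere) (beta : R) : Prop :=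
  forall b z0, chart b z0 = q ->
    exists l : R,
      conf_exp v b z - (beta - 1) * ln (enorm (z - z0)) @[z --> z0^'] --> l.

Definition spherical_cone_metric (k : nat) (beta : 'rV[R]_k)
    (p : 'I_k -> sphere) (v : sphere -> R) : Prop :=
  [/\ forall i, 0 < beta 0 i,
      injective p,
      smooth_sphere (~` range p) v,
      forall b z, ~ range p (chart b z) -> gauss_curvature v b z = 1 &
      forall i, conic_at v (p i) (beta 0 i)].

(* - div grad in the metric e^(2u) |dz|^2. The expression does not depend on
   the chart. *)
Definition laplacian_chart (v : sphere -> R) (b : bool) (f : sphere -> R)
    (z : plane) : R :=
  - expR (- 2 * conf_exp v b z) * flat_laplacian (f \o chart b) z.

Definition laplacian (v : sphere -> R) (f : sphere -> R) : sphere -> R :=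
  fun x => if x is Some z then laplacian_chart v false f z
           else laplacian_chart v true f 0.

(* Area density e^(2u) in the chart z |-> z; the point oo has measure zero. *)
Definition area_density (v : sphere -> R) (z : plane) : R :=
  expR (2 * conf_exp v false z).

Definition L2 (v : sphere -> R) : set (sphere -> R) :=
  [set f : sphere -> R | measurable_fun setT (f \o Some : plane -> R) /\
    (\int[leb2 R]_z ((f (Some z)) ^+ 2 * area_density v z)%:E < +oo)%E].

Definition L2_ip (v : sphere -> R) (f h : sphere -> R) : R :=
  Rintegral (leb2 R) setT
    (fun z : plane => f (Some z) * h (Some z) * area_density v z).

(* C_c^oo of the sphere minus P *)
Definition test_functions (P : set sphere) : set (sphere -> R) :=
  [set f : sphere -> R | smooth_sphere (~` P) f /\
    exists K : set sphere, [/\ compact K, K `<=` ~` P &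
      forall x, ~ K x -> f x = 0] ].

Definition laplace_spectrum (P : set sphere) (v : sphere -> R) : set R :=
  spectrum (L2 v) (L2_ip v)
    (friedrichs (L2 v) (L2_ip v) (test_functions P) (laplacian v)).

End metric.

Section mondello_panov.
Context {R : realType}.

Definition Zodd (k : nat) : set 'rV[int]_k :=
  [set gamma | exists m : int, \sum_i gamma 0 i = 2 * m + 1].

Definition d1 (k : nat) (x y : 'rV[R]_k) : R := \sum_i `|x 0 i - y 0 i|.

Definition d1_set (k : nat) (x : 'rV[R]_k) (A : set 'rV[R]_k) : R :=
  inf [set d1 x y | y in A].

Definition MP (k : nat) : set 'rV[R]_k :=
  [set beta : 'rV[R]_k | (forall i, 0 < beta 0 i) /\
    1 <= d1_set (beta - const_mx 1)
                [set map_mx (intr : int -> R) gamma | gamma in @Zodd k] ].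

End mondello_panov.

(* Main.v *)
Require Import Defs.
From mathcomp Require Import all_boot all_order all_algebra.
From mathcomp Require Import all_classical all_reals all_analysis.
From mathcomp Require Import measurable_realfun ring lra.
Set Implicit Arguments.
Unset Strict Implicit.
Unset Printing Implicit Defensive.
Import Order.TTheory GRing.Theory Num.Theory.
Import numFieldNormedType.Exports.
Local Open Scope classical_set_scope.
Local Open Scope ring_scope.

(* The metrics are pulled back from the round sphere by the multivalued map
   f = prod_j (z - a_j)^(r_j) with real exponents. Its monodromy consists of
   rotations about the vertical axis, so both the pulled back metric and the
   height function tanh (log |f|) are well defined on the sphere. With
   phi = log |f| and omega = df / f the metric is |omega|^2 / cosh^2 phi; its cone
   angles are 2 pi |r_j| at the poles of omega and 2 pi (1 + m) at its zeros of
   order m. The height function satisfies Delta F = 2 F, is bounded, and lies in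
   the Friedrichs domain because points have zero capacity, hence 2 is an
   eigenvalue.
   For the first claim take omega = d dz / z with d large (the other points are
   marked points of angle 2 pi). For the second one take
   omega = 48 d dz / ((z^2 - 1) (z^2 - 9)), which has residues -3 d, 3 d, d, -d at
   1, -1, 3, -3 and a double zero at oo: if d is half of an odd integer, the cone
   angle parameters 3 d, 3 d, d, d are at distance 1/2 from the integers, so the
   l^1 distance to the integer points is at least 2. *)

(** * Smooth functions on plane domains *)

(** Away from the marked points the metric is the pullback of the round one by a local isometry, and
    the height on the round sphere has eigenvalue 2. This and curvature 1 both reduce to |grad phi|
    = |omega|, since phi and log |omega| are harmonic there; in each example that is a rational
    identity in two coordinates. Formulas in the charts z and 1/z agree because the weights of phi
    sum to 0 (residue theorem) and the orders of omega to -2 (degree of the canonical divisor). With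
    oo marked and the other points on the real line, both charts use the same formulas with
    homogeneous coordinates exchanged. The analytic core is the Friedrichs domain. As F solves the
    eigenvalue equation, the energy of F chi is an L^2 term plus the integral of F^2 |grad chi|^2,
    so a bound on F suffices and grad F is never estimated near a cone point. Cone angles are kept
    at least 2 pi, so the metric is at most a constant times the round one and the area is finite.
    The football lies on the boundary of [MP], at l^1 distance exactly 1 from the odd points; hence
    the second family. *)

Section plane_calculus.
Context {R : realType}.
Local Notation plane := (R * R)%type.
Implicit Types (U : set plane) (f g : plane -> R) (z : plane) (i : bool).

Lemma is_derive_comp1 (h : R -> R) (dh : R) f z v :
  differentiable f z -> is_derive (f z) 1 h dh ->
  is_derive z v (h \o f) (dh * 'D_v f z).
Proof.
move=> df [hd <-].
have dh' : differentiable h (f z) by apply/derivable1_diffP.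
have dhf : differentiable (h \o f) z by exact: differentiable_comp.
apply: DeriveDef; first exact: diff_derivable.
rewrite (deriveE _ dhf) diff_comp //= (deriveE _ df).
have /= -> := deriv1E hd.
by rewrite derive1E mulrC.
Qed.

Lemma partial_comp (h : R -> R) (dh : R) f z i :
  differentiable f z -> is_derive (f z) 1 h dh ->
  partial i (fun x => h (f x)) z = dh * partial i f z.
Proof. by move=> df /(is_derive_comp1 (basis_vec i) df)[_ +]. Qed.

Lemma differentiable_comp1 (h : R -> R) (dh : R) f z :
  differentiable f z -> is_derive (f z) 1 h dh -> differentiable (h \o f) z.
Proof.
move=> df [hd _]; apply: differentiable_comp => //; exact/derivable1_diffP.
Qed.

Lemma near_partial f g z i :
  (\near z, f z = g z) -> partial i f z = partial i g z.
Proof. exact: near_eq_derive. Qed.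

(** Differentiability is local: [g - f] vanishes near [z], so its increment is a little-o with zero
    differential. *)
Lemma near_differentiable f g z :
  (\near z, f z = g z) -> differentiable f z -> differentiable g z.
Proof.
move=> fg df.
suff [dk _] : differentiable (g - f) z /\ True.
  by rewrite (_ : g = f + (g - f)); [exact: differentiableD|rewrite addrC subrK].
split=> //.
have kE : (g - f) \o shift z = cst ((g - f) z) + (0 : plane -> R) +o_ (0 : plane) id.
  apply/eqaddoP => e e0.
  have : \forall h \near (0 : plane), f (h + z) = g (h + z).
    by move: fg; rewrite (near_shift 0 z) /= subr0.
  apply: filterS => h fgh.
  rewrite !fctE /= /cst /= addr0 fgh subrr (nbhs_singleton fg) subrr subr0 normr0.
  by rewrite mulr_ge0// ltW.
apply/diff_locallyP.
have kd : 'd (g - f) z = 0 :> (plane -> R).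
  apply: diff_unique kE; exact: cst_continuous.
by rewrite kd; split=> //; exact: cst_continuous.
Qed.

Lemma partialD f g z i : differentiable f z -> differentiable g z ->
  partial i (fun x => f x + g x) z = partial i f z + partial i g z.
Proof. by move=> df dg; apply: deriveD; exact: diff_derivable. Qed.

Lemma partialB f g z i : differentiable f z -> differentiable g z ->
  partial i (fun x => f x - g x) z = partial i f z - partial i g z.
Proof. by move=> df dg; apply: deriveB; exact: diff_derivable. Qed.

Lemma partialM f g z i : differentiable f z -> differentiable g z ->
  partial i (fun x => f x * g x) z = f z * partial i g z + g z * partial i f z.
Proof. by move=> df dg; apply: deriveM; exact: diff_derivable. Qed.

Lemma partial_cst (a : R) z i : partial i (fun=> a) z = 0.
Proof. exact: derive_cst. Qed.

Lemma partialZ (a : R) f z i : differentiable f z ->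
  partial i (fun x => a * f x) z = a * partial i f z.
Proof. by move=> df; apply: deriveZ; exact: diff_derivable. Qed.

Lemma partial_sum (n : nat) (h : 'I_n -> plane -> R) z i :
  (forall j, differentiable (h j) z) ->
  partial i (fun x => \sum_j h j x) z = \sum_j partial i (h j) z.
Proof.
move=> dh; rewrite (_ : (fun x => _) = \sum_j h j).
  by apply: derive_sum => j; exact: diff_derivable.
by apply/funext => x; rewrite fct_sumE.
Qed.

Lemma open_near U (oU : open U) z f g : U z -> (forall x, U x -> f x = g x) ->
  \near z, f z = g z.
Proof.
move=> Uz fg; apply: filterS (open_nbhs_nbhs _) => //; last by split; [exact: oU|exact: Uz].
by move=> x /= /fg.
Qed.

(** Packages a smooth function [h 0] of one variable with all its derivatives, so that the chain
    rule only shifts the index. *)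
Definition derivative_chain (V : set R) (h : nat -> R -> R) :=
  forall n t, V t -> is_derive t (1:R) (h n) (h n.+1 t).

(* Enlarging the class of smooth functions so that it is syntactically closed
   under products and compositions makes it closed under [partial] (up to
   equality on [U]), hence consisting of smooth functions only. *)
Inductive smooth_closure U : (plane -> R) -> Prop :=
| smooth_closure_base f : smooth_on U f -> smooth_closure U f
| smooth_closure_add f g : smooth_closure U f -> smooth_closure U g ->
    smooth_closure U (fun x => f x + g x)
| smooth_closure_mul f g : smooth_closure U f -> smooth_closure U g ->
    smooth_closure U (fun x => f x * g x)
| smooth_closure_comp V h n f : derivative_chain V h -> smooth_closure U f ->
    (forall z, U z -> V (f z)) -> smooth_closure U (fun x => h n (f x)).

Lemma smooth_closure_differentiable U f z : smooth_closure U f -> U z ->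
  differentiable f z.
Proof.
move=> sf Uz; elim: sf => {f} [f /(_ [::] z Uz)//|f g _ df _ dg|f g _ df _ dg|].
- exact: differentiableD.
- exact: differentiableM.
- move=> V h n f hV _ df fV.
  by apply: (@differentiable_comp1 (h n) _ f z df); apply: hV; exact: fV.
Qed.

Lemma smooth_closure_partial U f i : smooth_closure U f ->
  exists2 g, smooth_closure U g & forall z, U z -> partial i f z = g z.
Proof.
elim=> {f} [f sf|f g sf [f' sf' ff'] sg [g' sg' gg']
   |f g sf [f' sf' ff'] sg [g' sg' gg']|V h n f hV sf [f' sf' ff'] fV].
- exists (partial i f) => //; apply: smooth_closure_base => s z Uz.
  by rewrite -foldr_rcons; exact: sf.
- exists (fun x => f' x + g' x); first exact: smooth_closure_add.
  move=> z Uz; rewrite partialD ?ff' ?gg'//;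
  exact: smooth_closure_differentiable Uz.
- exists (fun x => f x * g' x + g x * f' x).
    by apply: smooth_closure_add; exact: smooth_closure_mul.
  move=> z Uz; rewrite partialM ?ff' ?gg'//;
  exact: smooth_closure_differentiable Uz.
- exists (fun x => h n.+1 (f x) * f' x).
    by apply: smooth_closure_mul => //; exact: (smooth_closure_comp _ hV).
  move=> z Uz; rewrite -ff'//.
  apply: partial_comp; first exact: smooth_closure_differentiable Uz.
  by apply: hV; exact: fV.
Qed.

(** By induction on [s] the iterated partial agrees on [U] with a member of the closure, and members
    are differentiable. Openness of [U] lets an equality on [U] pass through one more [partial]. *)
Lemma smooth_closureP U f : open U -> smooth_closure U f -> smooth_on U f.
Proof.
move=> oU sf s.
suff [g sg fg] : exists2 g, smooth_closure U g &
    forall z, U z -> foldr partial f s z = g z.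
  move=> z Uz.
  apply: near_differentiable (smooth_closure_differentiable sg Uz).
  by apply: (open_near oU) => // x Ux; rewrite fg.
elim: s => [|i s [g sg fg]]; first by exists f.
have [g' sg' gg'] := smooth_closure_partial i sg.
exists g' => // z Uz /=; rewrite -gg'//; apply: near_partial.
by apply: (open_near oU) => // x Ux; rewrite fg.
Qed.

Lemma smooth_differentiable U f z : smooth_on U f -> U z -> differentiable f z.
Proof. by move=> /(_ [::] z). Qed.

Lemma smooth_partial U f i : smooth_on U f -> smooth_on U (partial i f).
Proof. by move=> sf s z Uz; rewrite -foldr_rcons; exact: sf. Qed.

Lemma smooth_cst U (a : R) : smooth_on U (fun=> a).
Proof.
move=> s z _; suff [b ->] : exists b : R, foldr partial (fun=> a) s = (fun=> b).
  exact: differentiable_cst.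
elim: s => [|i s [b /= ->]]; first by exists a.
by exists 0; apply/funext => x; exact: partial_cst.
Qed.

Lemma smoothD U f g : open U -> smooth_on U f -> smooth_on U g ->
  smooth_on U (fun x => f x + g x).
Proof.
by move=> oU sf sg; apply: smooth_closureP => //; apply: smooth_closure_add;
  exact: smooth_closure_base.
Qed.

Lemma smoothM U f g : open U -> smooth_on U f -> smooth_on U g ->
  smooth_on U (fun x => f x * g x).
Proof.
by move=> oU sf sg; apply: smooth_closureP => //; apply: smooth_closure_mul;
  exact: smooth_closure_base.
Qed.

Lemma smooth_comp U V h n f : open U -> derivative_chain V h -> smooth_on U f ->
  (forall z, U z -> V (f z)) -> smooth_on U (fun x => h n (f x)).
Proof.
move=> oU hV sf fV; apply: smooth_closureP => //.
by apply: smooth_closure_comp hV _ fV; exact: smooth_closure_base.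
Qed.

Lemma smooth_ext U f g : open U -> (forall z, U z -> f z = g z) ->
  smooth_on U f -> smooth_on U g.
Proof.
move=> oU fg sf s.
suff e : forall z, U z -> foldr partial f s z = foldr partial g s z.
  move=> z Uz; apply: near_differentiable (sf s z Uz).
  exact: open_near oU _ _ _ Uz e.
elim: s => [|i s IH] //= z Uz; apply: near_partial; exact: open_near oU _ _ _ Uz IH.
Qed.

Lemma smooth_sum U (n : nat) (h : 'I_n -> plane -> R) : open U ->
  (forall j, smooth_on U (h j)) -> smooth_on U (fun x => \sum_j h j x).
Proof.
move=> oU sh; elim: n h sh => [h _|n IH h sh].
  by apply: (smooth_ext oU _ (@smooth_cst U 0)) => z _; rewrite big_ord0.
apply: (smooth_ext oU (f := fun x => h ord0 x + \sum_j h (lift ord0 j) x)).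
  by move=> z _; rewrite big_ord_recl.
by apply: smoothD => //; apply: IH.
Qed.

End plane_calculus.

(** * Elementary smooth functions and a flat bump *)

Section elementary_smooth.
Context {R : realType}.
Local Notation plane := (R * R)%type.
Implicit Types (U : set plane) (f g : plane -> R) (z : plane) (i : bool).

Lemma differentiable_fst z : differentiable (fst : plane -> R) z.
Proof. by apply: linear_differentiable => x; exact: cvg_fst. Qed.

Lemma differentiable_snd z : differentiable (snd : plane -> R) z.
Proof. by apply: linear_differentiable => x; exact: cvg_snd. Qed.

Lemma partial_fst i z : partial i fst z = (~~ i)%:R :> R.
Proof.
rewrite /partial (deriveE _ (differentiable_fst z)) diff_lin; last first.
  by move=> x; exact: cvg_fst.
by case: i.
Qed.

Lemma partial_snd i z : partial i snd z = i%:R :> R.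
Proof.
rewrite /partial (deriveE _ (differentiable_snd z)) diff_lin; last first.
  by move=> x; exact: cvg_snd.
by case: i.
Qed.

Lemma smooth_fst U : smooth_on U (fst : plane -> R).
Proof.
(* [foldr] applies the last letter of [s] first, and that single derivative already leaves a
   constant. *)
move=> s z _; elim/last_ind: s => [|s i _]; first exact: differentiable_fst.
rewrite foldr_rcons (_ : partial i _ = fun=> (~~ i)%:R).
  exact: (@smooth_cst _ setT).
by apply/funext => x; exact: partial_fst.
Qed.

Lemma smooth_snd U : smooth_on U (snd : plane -> R).
Proof.
move=> s z _; elim/last_ind: s => [|s i _]; first exact: differentiable_snd.
rewrite foldr_rcons (_ : partial i _ = fun=> i%:R).
  exact: (@smooth_cst _ setT).
by apply/funext => x; exact: partial_snd.
Qed.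

Lemma smoothN U f : open U -> smooth_on U f -> smooth_on U (fun x => - f x).
Proof.
move=> oU sf; apply: (smooth_ext oU (f := fun x => -1 * f x)).
  by move=> z _; rewrite mulN1r.
by apply: smoothM => //; exact: smooth_cst.
Qed.

Lemma smoothB U f g : open U -> smooth_on U f -> smooth_on U g ->
  smooth_on U (fun x => f x - g x).
Proof. by move=> oU sf sg; apply: smoothD => //; exact: smoothN. Qed.

Lemma smoothX U f n : open U -> smooth_on U f -> smooth_on U (fun x => f x ^+ n).
Proof.
move=> oU sf; elim: n => [|n IH]; first exact: smooth_cst.
apply: (smooth_ext oU (f := fun x => f x * f x ^+ n)).
  by move=> z _; rewrite exprS.
exact: smoothM.
Qed.

Lemma expR_chain : derivative_chain setT (fun _ : nat => @expR R).
Proof. by move=> n t _; exact: is_derive_expR. Qed.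

(** The [n]-th derivative of [1 / x]. *)
Definition inv_iter (n : nat) (x : R) : R := (-1) ^+ n * n`!%:R * x^-1 ^+ n.+1.

Lemma inv_iter_chain : derivative_chain [set x : R | x != 0] inv_iter.
Proof.
move=> n t /= t0; rewrite /inv_iter.
have d1 : is_derive t 1 (fun y : R => y^-1) (- t ^- 2).
  by apply: is_derive_eq; first exact: (is_deriveV (f := id)); rewrite /= /GRing.scale /= mulr1.
have -> : (fun x : R => (-1) ^+ n * n`!%:R * x^-1 ^+ n.+1) =
  (((-1) ^+ n * n`!%:R) \*: ((fun y : R => y^-1) ^+ n.+1)).
  by apply/funext => x; rewrite /= exprfctE.
apply: is_derive_eq.
rewrite factS natrM -exprVn /GRing.scale /=.
rewrite (exprS (-1)) (exprSr t^-1 n.+1) (exprSr t^-1 n) expr2.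
by move: (_ ^+ n) (_ ^+ n) n`!%:R n.+1%:R => a b c d; ring.
Qed.

Lemma ln_chain : derivative_chain [set x : R | 0 < x]
  (fun n => if n is m.+1 then inv_iter m else @ln R).
Proof.
move=> [|n] t /= t0; last by apply: inv_iter_chain => /=; rewrite gt_eqF.
rewrite /inv_iter expr0 fact0 expr1 !mul1r; exact: is_derive1_ln.
Qed.

Lemma smooth_expR U f : open U -> smooth_on U f ->
  smooth_on U (fun x => expR (f x)).
Proof. by move=> oU sf; apply: (smooth_comp 0%N oU expR_chain sf). Qed.

Lemma smooth_inv U f : open U -> smooth_on U f ->
  (forall z, U z -> f z != 0) -> smooth_on U (fun x => (f x)^-1).
Proof.
move=> oU sf f0.
apply: (smooth_ext oU _ (smooth_comp 0%N oU inv_iter_chain sf f0)) => z Uz.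
by rewrite /inv_iter expr0 fact0 expr1 !mul1r.
Qed.

Lemma smooth_ln U f : open U -> smooth_on U f ->
  (forall z, U z -> 0 < f z) -> smooth_on U (fun x => ln (f x)).
Proof. by move=> oU sf f0; exact: (smooth_comp 0%N oU ln_chain sf f0). Qed.

(* All derivatives of exp (-1 / t), t > 0, are of the form p (1 / t) exp (-1 / t). *)
Definition flat_bump (p : {poly R}) (t : R) : R :=
  if 0 < t then p.[t^-1] * expR (- t^-1) else 0.

(** With u = 1 / t, du / dt = - u^2, so the derivative of p(u) exp (- u) in t is u^2 (p - p')(u) exp
    (- u). *)
Definition flat_bump_deriv (p : {poly R}) : {poly R} := 'X^2 * (p - p^`()).

(** Monomial by monomial, from x^(i+1) <= (i+1)! exp x. The extra factor x becomes the factor |t| in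
    the bound on [flat_bump]. *)
Lemma poly_expR_bound (p : {poly R}) : exists2 C : R, 0 <= C &
  forall x, 0 < x -> `|p.[x]| * x <= C * expR x.
Proof.
exists (\sum_(i < size p) `|p`_i| * i.+1`!%:R); first by apply: sumr_ge0 => i _; rewrite mulr_ge0.
move=> x x0; rewrite horner_coef mulr_suml.
apply: (@le_trans _ _ ((\sum_(i < size p) `|p`_i * x ^+ i|) * x)).
  by rewrite ler_pM2r//; exact: ler_norm_sum.
rewrite mulr_suml; apply: ler_sum => i _.
rewrite normrM (ger0_norm (exprn_ge0 _ (ltW x0))) -!mulrA; apply: ler_wpM2l => //.
rewrite -exprSr -ler_pdivrMl ?ltr0n ?fact_gt0// mulrC.
by apply: le_trans (expR_ge1Dxn i (ltW x0)); rewrite lerDr.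
Qed.

Lemma flat_bump_bound (p : {poly R}) : exists2 C : R, 0 <= C &
  forall t, `|flat_bump p t| <= C * `|t|.
Proof.
have [C C0 HC] := poly_expR_bound p; exists C => // t; rewrite /flat_bump.
case: ifPn => t0; last by rewrite normr0 mulr_ge0.
rewrite (gtr0_norm t0) normrM (ger0_norm (expR_ge0 _)) expRN ler_pdivrMr ?expR_gt0//.
have := HC t^-1; rewrite invr_gt0 => /(_ t0).
by rewrite ler_pdivrMr// => /le_trans; apply; rewrite mulrAC.
Qed.

Lemma flat_bump_chain (p : {poly R}) :
  derivative_chain setT (fun n => flat_bump (iter n flat_bump_deriv p)).
Proof.
move=> n t _ /=; move: (iter n _ p) => {}p.
have [t0|t0|->] := ltgtP t 0.
- rewrite {2}/flat_bump (ltNge 0 t) (ltW t0) /=.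
  apply: (near_eq_is_derive _ (is_derive_cst (0:R) t 1)).
  near=> u; rewrite /flat_bump ifN// -leNgt ltW//; near: u; exact: lt_nbhsl.
- have d1 : is_derive t 1 (fun y : R => y^-1) (- t ^- 2).
    apply: is_derive_eq; first by apply: (is_deriveV (f := id)); rewrite /= gt_eqF.
    by rewrite /= /GRing.scale /= mulr1.
  have d2 := is_derive1_comp (g := - (fun y : R => y^-1)) (is_derive_expR (- t^-1)) (is_deriveN d1).
  have d3 := is_deriveM (is_derive1_comp (is_derive_poly p t^-1) d1) d2.
  apply: (near_eq_is_derive _ (is_derive_eq d3 _)).
    near=> u; rewrite /flat_bump ifT//; near: u; exact: lt_nbhsr.
  rewrite /flat_bump t0 /flat_bump_deriv !hornerE /GRing.scale /= -exprVn.
  rewrite [(- _) t]/(- t^-1).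
  by set E := expR _; ring.
- have -> : flat_bump (flat_bump_deriv p) 0 = 0 by rewrite /flat_bump ltxx.
  (* At 0 the difference quotient of [flat_bump p] is [flat_bump ('X * p)], since dividing by t
     multiplies p(1 / t) by 1 / t; the linear bound makes it continuous there. *)
  apply/is_derive1_caratheodory; exists (flat_bump ('X * p)); split.
  + move=> z; rewrite /flat_bump ltxx !subr0; case: ifPn => z0; last by rewrite mul0r.
    rewrite hornerM hornerX; move: (p.[_]) (expR _) => a b; have zn0 : z != 0 by rewrite gt_eqF.
    by field.
  + have [C C0 HC] := flat_bump_bound ('X * p).
    rewrite /prop_for /continuous_at {2}/flat_bump ltxx.
    apply/cvgr0Pnorm_lt => e e0.
    have C1 : 0 < C + 1 by rewrite ltr_wpDl.
    near=> z; apply: (le_lt_trans (HC z)).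
    apply: (@le_lt_trans _ _ ((C + 1) * `|z|)); first by rewrite ler_wpM2r// lerDl.
    rewrite -ltr_pdivlMl// mulrC; near: z.
    have := @nbhs0_lt R R (e / (C + 1)); rewrite divr_gt0// => /(_ isT).
    exact.
  + by rewrite /flat_bump ltxx.
Unshelve. all: by end_near. Qed.

Definition bumpR : R -> R := flat_bump 1.

Lemma bump_ge0 t : 0 <= bumpR t.
Proof. by rewrite /bumpR /flat_bump; case: ifP => // _; rewrite hornerC mul1r expR_ge0. Qed.

Lemma bump_le t : t <= 1 -> bumpR t <= expR (-1).
Proof.
move=> t1; rewrite /bumpR /flat_bump; case: ifPn => t0; last exact: expR_ge0.
by rewrite hornerC mul1r ler_expR lerN2 invf_ge1.
Qed.

Lemma bump1 : bumpR 1 = expR (-1).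
Proof. by rewrite /bumpR /flat_bump ltr01 hornerC mul1r invr1. Qed.

Lemma bump_le0 t : t <= 0 -> bumpR t = 0.
Proof. by rewrite /bumpR /flat_bump ltNge => ->. Qed.

Definition bumpR' : R -> R := flat_bump (flat_bump_deriv 1).

Lemma bumpR'_le0 t : t <= 0 -> bumpR' t = 0.
Proof. by rewrite /bumpR' /flat_bump ltNge => ->. Qed.

Lemma is_derive_bump (t : R) : is_derive t (1:R) bumpR (bumpR' t).
Proof. by have := @flat_bump_chain 1 0%N t I. Qed.

(** With x = 1 / t this is x^2 <= 2 exp x, read off the quadratic Taylor term. *)
Lemma bumpR'_bound t : `|bumpR' t| <= 2.
Proof.
rewrite /bumpR' /flat_bump; case: ifPn => t0; last by rewrite normr0.
rewrite /flat_bump_deriv derivC subr0 mulr1 hornerXn normrM normrX.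
rewrite (gtr0_norm (expR_gt0 _)) gtr0_norm ?invr_gt0// expRN ler_pdivrMr ?expR_gt0//.
have := @expR_ge1Dxn R t^-1 1; rewrite invr_ge0 (ltW t0) => /(_ isT).
rewrite (_ : 2`! = 2)%N// => h; set x := t^-1 in h *; lra.
Qed.

Lemma smooth_bump U f : open U -> smooth_on U f ->
  smooth_on U (fun x => bumpR (f x)).
Proof.
by move=> oU sf; apply: (smooth_comp 0%N oU (@flat_bump_chain 1) sf).
Qed.

End elementary_smooth.

(** * Integration on the plane *)

Section measure_space.
Context d (T : measurableType d) (R : realType) (mu : {measure set T -> \bar R}).

Lemma integrable_scaled_indic (c : R) A : measurable A -> (mu A < +oo)%E ->
  mu.-integrable setT (EFin \o (fun z => c * \1_A z)).
Proof.
move=> mA muA.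
suff h : mu.-integrable setT (EFin \o \1_A).
  have := integrableZl measurableT c h.
  by apply: eq_integrable => // x _.
apply/integrableP; split; first exact/measurable_EFinP/measurable_indic.
rewrite (eq_integral (fun z => (\1_A z)%:E)); last first.
  by move=> t _; rewrite gee0_abs// lee_fin.
by rewrite integral_indic// setIT.
Qed.

Lemma Rintegral_scaled_indic (c : R) A : measurable A -> (mu A < +oo)%E ->
  Rintegral mu setT (fun z => c * \1_A z) = c * fine (mu A).
Proof.
move=> mA muA; rewrite RintegralZl//; last first.
  apply: eq_integrable (integrable_scaled_indic 1 mA muA) => //.
  by move=> x _ /=; rewrite mul1r.
by rewrite /Rintegral integral_indic// setIT.
Qed.

Lemma le_integrable_real (f g : T -> R) : measurable_fun setT f ->
  (forall z, `|f z| <= g z) -> mu.-integrable setT (EFin \o g) ->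
  mu.-integrable setT (EFin \o f).
Proof.
move=> mf fg; apply: le_integrable => //; first exact/measurable_EFinP.
by move=> z _; rewrite /= lee_fin (le_trans (fg z))// ler_norm.
Qed.

End measure_space.

Section plane_integration.
Context {R : realType}.
Local Notation plane := (R * R)%type.
Implicit Types (f g : plane -> R) (z : plane) (i : bool).

(** The plane carries the product sigma-algebra, so an open set is written as a countable union of
    boxes with rational centre and radius. *)
Lemma open_measurable_plane (U : set plane) : open U -> measurable U.
Proof.
move=> oU.
pose box (a b c : rat) : set plane := ball (ratr a : R) (ratr c) `*` ball (ratr b : R) (ratr c).
suff -> : U = \bigcup_a \bigcup_b \bigcup_c
    (if `[< box a b c `<=` U >] then box a b c else set0).
  do 3! (apply: bigcupT_measurable_rat => ?).
  by case: ifP => // _; apply: measurableX; apply: open_measurable; exact: ball_open.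
apply/seteqP; split=> [[x y] Uxy|z [a _ [b _ [c _]]]]; last first.
  by case: ifPn => // /asboolP; apply.
have : nbhs (x, y) U by exact: open_nbhs_nbhs.
move=> [[A B] [/= /nbhs_ballP[e1 /= e10 e1A] /nbhs_ballP[e2 /= e20 e2B] ABU]].
pose e := Num.min e1 e2; have e0 : 0 < e by rewrite lt_min e10.
have eh : 0 < e / 2 by rewrite divr_gt0.
have /rat_in_itvoo[c] : 0 < e / 2 by [].
rewrite in_itv /= => /andP[c0 ce].
have /rat_in_itvoo[a] : x - ratr c < x + ratr c by rewrite ltrBlDr -addrA ltrDl addr_gt0.
have /rat_in_itvoo[b] : y - ratr c < y + ratr c by rewrite ltrBlDr -addrA ltrDl addr_gt0.
rewrite !in_itv /= -!ltr_distl => yb xa.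
exists a => //; exists b => //; exists c => //; rewrite ifT; first by split=> /=.
apply/asboolP => -[u v] [/= ua vb]; apply: ABU; rewrite /ball /= in ua vb.
split; [apply: e1A|apply: e2B]; rewrite /= /ball /=.
- apply: (@lt_le_trans _ _ e); last by rewrite ge_min lexx.
  rewrite -(subrK (ratr a) x) -addrA (le_lt_trans (ler_normD _ _))// (splitr e).
  by rewrite ltrD// ?(lt_trans ua)// distrC (lt_trans xa).
- apply: (@lt_le_trans _ _ e); last by rewrite ge_min lexx orbT.
  rewrite -(subrK (ratr b) y) -addrA (le_lt_trans (ler_normD _ _))// (splitr e).
  by rewrite ltrD// ?(lt_trans vb)// distrC (lt_trans yb).
Qed.

Lemma continuous_measurable_plane f : continuous f -> measurable_fun setT f.
Proof.
move=> /continuousP cf; apply: (measurability _ (RGenOpens.measurableE R)).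
move=> _ [_ [a [b ->] <-]]; rewrite setTI; apply: open_measurable_plane.
exact/cf/interval_open.
Qed.

Definition square (a b s : R) : set plane := `[a - s, a + s] `*` `[b - s, b + s].

Lemma measurable_square a b s : measurable (square a b s).
Proof. by apply: measurableX. Qed.

Lemma measure_square a b s : 0 <= s ->
  leb2 R (square a b s) = (4 * s ^+ 2)%:E.
Proof.
move=> s0.
have e c : lebesgue_measure (`[c - s, c + s]%classic : set R) = (2 * s)%:E.
  rewrite lebesgue_measure_itv /= lte_fin; case: ifPn => h.
    by rewrite -EFinB; congr (_%:E); ring.
  by congr (_%:E); move: h; rewrite -leNgt; lra.
rewrite /square product_measure1E//.
transitivity ((2 * s)%:E * (2 * s)%:E)%E; first by congr (_ * _)%E; exact: e.
by rewrite -EFinM; congr (_%:E); ring.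
Qed.

Definition integrable2 f := (leb2 R).-integrable setT (EFin \o f).

Definition integral2 f : R := Rintegral (leb2 R) setT f.

Lemma integrable2_square a b s (c : R) : 0 <= s ->
  integrable2 (fun z => c * \1_(square a b s) z).
Proof.
move=> s0; have h : (leb2 R (square a b s) < +oo)%E by rewrite measure_square// ltry.
exact (@integrable_scaled_indic _ _ _ (leb2 R) c _ (measurable_square a b s) h).
Qed.

Lemma integral2_square a b s (c : R) : 0 <= s ->
  integral2 (fun z => c * \1_(square a b s) z) = c * (4 * s ^+ 2).
Proof.
move=> s0; have e := measure_square a b s0.
have h : (leb2 R (square a b s) < +oo)%E by rewrite e ltry.
transitivity (c * fine (leb2 R (square a b s))); last by rewrite e.
exact (@Rintegral_scaled_indic _ _ _ (leb2 R) c _ (measurable_square a b s) h).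
Qed.

Lemma le_integrable2 f g : measurable_fun setT f -> (forall z, `|f z| <= g z) ->
  integrable2 g -> integrable2 f.
Proof. exact (@le_integrable_real _ _ _ (leb2 R) f g). Qed.

Lemma integrable2D f g : integrable2 f -> integrable2 g ->
  integrable2 (fun z => f z + g z).
Proof. move=> hf hg; exact (@integrableD _ _ _ (leb2 R) _ measurableT _ _ hf hg). Qed.

Lemma integrable2Z (c : R) f : integrable2 f -> integrable2 (fun z => c * f z).
Proof. move=> hf; exact (@integrableZl _ _ _ (leb2 R) _ measurableT c _ hf). Qed.

Lemma integral2D f g : integrable2 f -> integrable2 g ->
  integral2 (fun z => f z + g z) = integral2 f + integral2 g.
Proof. move=> hf hg; exact (@RintegralD _ _ _ (leb2 R) _ _ _ measurableT hf hg). Qed.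

Lemma integral2B f g : integrable2 f -> integrable2 g ->
  integral2 (fun z => f z - g z) = integral2 f - integral2 g.
Proof. move=> hf hg; exact (@RintegralB _ _ _ (leb2 R) _ _ _ measurableT hf hg). Qed.

Lemma integral2Z (c : R) f : integrable2 f ->
  integral2 (fun z => c * f z) = c * integral2 f.
Proof. move=> hf; exact (@RintegralZl _ _ _ (leb2 R) _ _ c measurableT hf). Qed.

Lemma le_integral2 f g : integrable2 f -> integrable2 g ->
  (forall z, f z <= g z) -> integral2 f <= integral2 g.
Proof.
move=> hf hg fg.
exact (@le_Rintegral _ _ _ (leb2 R) _ _ _ measurableT hf hg (fun z _ => fg z)).
Qed.

Lemma integrable2_sum (n : nat) (h : 'I_n -> plane -> R) :
  (forall j, integrable2 (h j)) -> integrable2 (fun z => \sum_j h j z).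
Proof.
move=> hi; elim: n h hi => [|n IH] h hi.
  apply: eq_integrable (integrable2_square 0 0 0 (lexx 0)) => //.
  by move=> z _ /=; rewrite big_ord0 mul0r.
apply: eq_integrable (integrable2D (hi ord0) (IH _ (fun j => hi (lift ord0 j)))) => //.
by move=> z _ /=; rewrite big_ord_recl.
Qed.

Lemma integral2_sum (n : nat) (h : 'I_n -> plane -> R) :
  (forall j, integrable2 (h j)) ->
  integral2 (fun z => \sum_j h j z) = \sum_j integral2 (h j).
Proof.
move=> hi; elim: n h hi => [|n IH] h hi.
  rewrite big_ord0 -[RHS](mul0r (4 * 0 ^+ 2)) -(integral2_square 0 0 0 (lexx 0)).
  by congr integral2; apply/funext => z; rewrite big_ord0 mul0r.
rewrite big_ord_recl -IH// -integral2D//; last exact: integrable2_sum.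
by congr integral2; apply/funext => z; rewrite big_ord_recl.
Qed.

Lemma integrable2_compact f (M : R) : continuous f ->
  (forall z, M < `|z| -> f z = 0) -> integrable2 f.
Proof.
move=> cf f0; set N := Num.max M 0.
have N0 : 0 <= N by rewrite le_max lexx orbT.
have cK : compact (square 0 0 N : set plane).
  by apply: compact_setX; exact: segment_compact.
have [C [_ HC]] : bounded_set (f @` square 0 0 N).
  by apply: compact_bounded; apply: continuous_compact => //; exact: continuous_subspaceT.
have := HC (C + 1); rewrite ltrDl ltr01 => /(_ isT) {}HC.
apply: (@le_integrable2 _ (fun z => (C + 1) * \1_(square 0 0 N) z)).
- exact: continuous_measurable_plane.
- move=> z; rewrite indicE; case: (boolP (z \in square 0 0 N)) => zN.
    by rewrite mulr1; apply: HC; exists z => //; rewrite -in_setE.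
  rewrite mulr0 f0 ?normr0//; rewrite ltNge; apply: contra zN => zM.
  have : `|z| <= N by rewrite le_max zM.
  rewrite /Num.norm /= ge_max => /andP[z1 z2].
  by rewrite inE; split; rewrite /= in_itv /= sub0r add0r -ler_norml.
- exact: integrable2_square.
Qed.

Lemma is_derive_slice1 f x y : differentiable f (x, y) ->
  is_derive x (1 : R) (fun t => f (t, y)) (partial false f (x, y)).
Proof.
move=> df; have := diff_derivable (v := basis_vec false) df.
have e : (fun h : R => h^-1 *: (f (h *: basis_vec false + (x, y)) - f (x, y))) =
         (fun h => h^-1 *: (f (h *: 1 + x, y) - f (x, y))).
  apply/funext => h; congr (_ *: (f _ - _)).
  by congr pair; rewrite /= /GRing.scale /= ?mulr1 ?mulr0 ?add0r.
move=> d; apply: DeriveDef.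
  by move: d; rewrite /derivable e.
by rewrite /partial /derive e.
Qed.

Lemma is_derive_slice2 f x y : differentiable f (x, y) ->
  is_derive y (1 : R) (fun t => f (x, t)) (partial true f (x, y)).
Proof.
move=> df; have := diff_derivable (v := basis_vec true) df.
have e : (fun h : R => h^-1 *: (f (h *: basis_vec true + (x, y)) - f (x, y))) =
         (fun h => h^-1 *: (f (x, h *: 1 + y) - f (x, y))).
  apply/funext => h; congr (_ *: (f _ - _)).
  by congr pair; rewrite /= /GRing.scale /= ?mulr1 ?mulr0 ?add0r.
move=> d; apply: DeriveDef.
  by move: d; rewrite /derivable e.
by rewrite /partial /derive e.
Qed.

Lemma integral_derivative_compact (h h' : R -> R) (M : R) :
  (forall x, is_derive x (1:R) h (h' x)) -> continuous h' ->
  (forall x, M < `|x| -> h x = 0) -> (forall x, M < `|x| -> h' x = 0) ->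
  (\int[lebesgue_measure]_x (h' x)%:E = 0)%E.
Proof.
move=> dh ch' h0 h'0.
(* Strictly beyond [M] and positive, so that [h] vanishes at both ends of [[- N, N]]. *)
set N := Num.max M 0 + 1.
have N0 : 0 < N by rewrite /N ltr_wpDl// le_max lexx orbT.
have MN : M < N by rewrite /N (@le_lt_trans _ _ (Num.max M 0)) ?ltrDl// le_max lexx.
transitivity (\int[lebesgue_measure]_(x in `[(- N)%R, N]) (h' x)%:E)%E.
  rewrite [RHS]integral_mkcond; apply: eq_integral => x _; rewrite patchE.
  case: ifPn => // xN; rewrite h'0//; apply: (lt_trans MN).
  rewrite ltNge; apply: contra xN => xN.
  by rewrite inE /= in_itv /= -ler_norml.
have dh1 x : derivable h x 1 by case: (dh x).
rewrite (continuous_FTC2 (F := h)).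
- by rewrite (h0 N) ?(h0 (- N)) ?subee// ?normrN gtr0_norm.
- by rewrite (lt_trans _ N0)// oppr_lt0.
- exact: continuous_subspaceT.
- have ch : continuous h by move=> x; apply/differentiable_continuous/derivable1_diffP/dh1.
  split => //.
  + by apply: cvg_at_right_filter; exact: ch.
  + by apply: cvg_at_left_filter; exact: ch.
- by move=> x _; rewrite derive1E; case: (dh x).
Qed.

Lemma partial_eq0 f i M : (forall z, M < `|z| -> f z = 0) ->
  forall z, M < `|z| -> partial i f z = 0.
Proof.
move=> f0 z Mz; rewrite (near_partial (g := fun=> 0)) ?partial_cst//.
have /cvgr_gt /(_ _ Mz) := @norm_continuous _ _ z.
by apply: filterS => w /f0.
Qed.

(** By Fubini, integrating first in the direction of the derivative, every inner integral is that of
    a compactly supported derivative. *)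
Lemma divergence_theorem f i M : (forall z, differentiable f z) ->
  continuous (partial i f) -> (forall z, M < `|z| -> f z = 0) ->
  integrable2 (partial i f) /\ integral2 (partial i f) = 0.
Proof.
move=> df cf f0; have pf0 := partial_eq0 i f0.
have ipf : integrable2 (partial i f) by exact: integrable2_compact cf pf0.
split=> //; rewrite /integral2 /Rintegral.
have normp (x y : R) : M < `|x| \/ M < `|y| -> M < `|(x, y)|.
  by rewrite /Num.norm /= lt_max => -[->//|->]; rewrite orbT.
have cx x : continuous (fun y => partial i f (x, y)).
  move=> y; apply: (@continuous_comp _ _ _ (fun y => (x, y)) (partial i f)); last exact: cf.
  rewrite /prop_for /continuous_at.
  by apply: (@cvg_pair _ _ _ _ (nbhs x) (nbhs y) _ _ _ (fun=> x) id); [exact: cvg_cst|exact: cvg_id].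
have cy y : continuous (fun x => partial i f (x, y)).
  move=> x; apply: (@continuous_comp _ _ _ (fun x => (x, y)) (partial i f)); last exact: cf.
  rewrite /prop_for /continuous_at.
  by apply: (@cvg_pair _ _ _ _ (nbhs x) (nbhs y) _ _ _ id (fun=> y)); [exact: cvg_id|exact: cvg_cst].
case: i ipf pf0 cf cx cy => ipf pf0 cf cx cy.
- rewrite -(integral12_prod_meas1 ipf) /fubini_F /=.
  rewrite integral0_eq// => x _.
  apply: (@integral_derivative_compact (fun y => f (x, y)) _ M) => //.
  + by move=> y; exact: is_derive_slice2.
  + by move=> y My; apply: f0; apply: normp; right.
  + by move=> y My; apply: pf0; apply: normp; right.
- rewrite -(integral21_prod_meas1 ipf) /fubini_G /=.
  rewrite integral0_eq// => y _.
  apply: (@integral_derivative_compact (fun x => f (x, y)) _ M) => //.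
  + by move=> x; exact: is_derive_slice1.
  + by move=> x Mx; apply: f0; apply: normp; left.
  + by move=> x Mx; apply: pf0; apply: normp; left.
Qed.

End plane_integration.

(** * Conformal metrics with logarithmic potentials *)

Section hyperbolic.
Context {R : realType}.
Implicit Types t : R.

Definition lncosh t : R := ln ((expR t + expR (- t)) / 2).

Definition th t : R := (expR t - expR (- t)) / (expR t + expR (- t)).

Lemma cosh_gt0 t : 0 < expR t + expR (- t).
Proof. by rewrite addr_gt0// expR_gt0. Qed.

Let dexpN t : is_derive t (1:R) (fun u : R => expR (- u)) (- expR (- t)).
Proof.
have := is_derive1_comp (g := -%R) (is_derive_expR (- t)) (is_deriveNid t 1).
by rewrite mulrN1.
Qed.

Lemma is_derive_th t : is_derive t (1:R) th (1 - th t ^+ 2).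
Proof.
have c0 : expR t + expR (- t) != 0 by rewrite gt_eqF// cosh_gt0.
have d1 := is_deriveB (is_derive_expR t) (dexpN t).
have d2 := is_deriveV (f := expR + (fun u => expR (- u))) c0
  (is_deriveD (is_derive_expR t) (dexpN t)).
apply: (is_derive_eq (is_deriveM d1 d2)).
rewrite /GRing.scale /= /th !fctE.
by move: (expR t) (expR (- t)) c0 => x y c0; field.
Qed.

Lemma is_derive_lncosh t : is_derive t (1:R) lncosh (th t).
Proof.
have c0 : 0 < (expR t + expR (- t)) / 2 by rewrite divr_gt0// cosh_gt0.
have d1 := is_deriveM (is_deriveD (is_derive_expR t) (dexpN t)) (is_derive_cst (2^-1:R) t 1).
have := is_derive1_comp (g := (expR + (fun u => expR (- u))) * cst 2^-1) (is_derive1_ln c0) d1.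
move/is_derive_eq; apply.
have := cosh_gt0 t => /lt0r_neq0; rewrite /GRing.scale /= /th !fctE /cst.
by move: (expR t) (expR (- t)) => x y c1; field.
Qed.

Lemma expR_lncosh t : expR (- (2 * lncosh t)) = 1 - th t ^+ 2.
Proof.
have c0 : 0 < (expR t + expR (- t)) / 2 by rewrite divr_gt0// cosh_gt0.
rewrite expRN expRM_natl lnK ?posrE//.
have e1 := expRxMexpNx_1 t; have := cosh_gt0 t => /lt0r_neq0; rewrite /th.
move: (expR t) (expR (- t)) e1 => x y e1 c1.
transitivity (4 * (x * y) / (x + y) ^+ 2); first by rewrite e1; field.
by field.
Qed.

Lemma th_lt1 t : `|th t| <= 1.
Proof.
rewrite /th normrM normfV (gtr0_norm (cosh_gt0 t)) ler_pdivrMr ?cosh_gt0// mul1r.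
have := expR_gt0 t; have := expR_gt0 (- t); rewrite ler_norml; lra.
Qed.

Lemma th_eq0 t : (th t == 0) = (t == 0).
Proof.
rewrite /th mulf_eq0 invr_eq0 (gt_eqF (cosh_gt0 t)) orbF subr_eq0.
by rewrite (inj_eq (@expR_inj R)) -subr_eq0 opprK -mulr2n mulrn_eq0.
Qed.

Lemma smooth_th (U : set (R * R)) f : open U -> smooth_on U f ->
  smooth_on U (fun z => th (f z)).
Proof.
move=> oU sf; have se := smooth_expR oU sf.
have seN := smooth_expR oU (smoothN oU sf).
apply: smoothM => //; first exact: smoothB.
apply: smooth_inv => //; first exact: smoothD.
by move=> z _; rewrite gt_eqF// cosh_gt0.
Qed.

Lemma smooth_lncosh (U : set (R * R)) f : open U -> smooth_on U f ->
  smooth_on U (fun z => lncosh (f z)).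
Proof.
move=> oU sf; apply: smooth_ln => // [|z _]; last by rewrite divr_gt0// cosh_gt0.
apply: smoothM => //; last exact: smooth_cst.
by apply: smoothD => //; apply: smooth_expR => //; exact: smoothN.
Qed.

Lemma continuous_th : continuous th.
Proof.
by move=> t; apply/differentiable_continuous/derivable1_diffP; case: (is_derive_th t).
Qed.

Lemma continuous_lncosh : continuous lncosh.
Proof.
by move=> t; apply/differentiable_continuous/derivable1_diffP; case: (is_derive_lncosh t).
Qed.

End hyperbolic.

Section laplacian_calculus.
Context {R : realType}.
Local Notation plane := (R * R)%type.
Implicit Types (f g : plane -> R) (z : plane) (U : set plane).

Definition grad_dot f g z : R :=
  partial false f z * partial false g z + partial true f z * partial true g z.

Lemma smooth_partial_differentiable U f z i : smooth_on U f -> U z ->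
  differentiable (partial i f) z.
Proof. by move=> sf; apply: smooth_differentiable; exact: smooth_partial. Qed.

Lemma flat_laplacian_ext U f g z : open U -> (forall x, U x -> f x = g x) ->
  U z -> flat_laplacian f z = flat_laplacian g z.
Proof.
move=> oU fg Uz.
have e i x : U x -> partial i f x = partial i g x.
  by move=> Ux; apply: near_partial; exact: open_near oU _ _ _ Ux fg.
have e2 i : partial i (partial i f) z = partial i (partial i g) z.
  by apply: near_partial; exact: open_near oU _ _ _ Uz (e i).
by rewrite /flat_laplacian !e2.
Qed.

Lemma flat_laplacianD U f g z : open U -> smooth_on U f -> smooth_on U g ->
  U z -> flat_laplacian (fun x => f x + g x) z =
  flat_laplacian f z + flat_laplacian g z.
Proof.
move=> oU sf sg Uz.
have e i : partial i (partial i (fun x => f x + g x)) z =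
    partial i (partial i f) z + partial i (partial i g) z.
  rewrite -partialD; [|exact: smooth_partial_differentiable Uz..].
  apply: near_partial; apply: (open_near oU) => // x Ux.
  by rewrite partialD//; exact: smooth_differentiable Ux.
by rewrite /flat_laplacian (e false) (e true); exact: addrACA.
Qed.

Lemma flat_laplacianM U f g z : open U -> smooth_on U f -> smooth_on U g ->
  U z -> flat_laplacian (fun x => f x * g x) z =
  f z * flat_laplacian g z + 2 * grad_dot f g z + g z * flat_laplacian f z.
Proof.
move=> oU sf sg Uz.
have e i : partial i (partial i (fun x => f x * g x)) z =
    f z * partial i (partial i g) z + 2 * (partial i f z * partial i g z) +
    g z * partial i (partial i f) z.
  have df := smooth_differentiable sf Uz.
  have dg := smooth_differentiable sg Uz.
  have dpf := smooth_partial_differentiable i sf Uz.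
  have dpg := smooth_partial_differentiable i sg Uz.
  rewrite (near_partial (g := fun x => f x * partial i g x + g x * partial i f x)).
    rewrite partialD; [|exact: differentiableM..].
    rewrite !partialM//.
    by move: (partial i (partial i f) z) (partial i (partial i g) z)
      (partial i f z) (partial i g z) => a b c d; ring.
  apply: (open_near oU) => // x Ux.
  by rewrite partialM//; exact: smooth_differentiable Ux.
rewrite /flat_laplacian /grad_dot (e false) (e true).
move: (partial false (partial false f) z) (partial false (partial false g) z)
  (partial true (partial true f) z) (partial true (partial true g) z)
  (partial false f z) (partial false g z) (partial true f z) (partial true g z).
by move=> a b c d a' b' c' d'; ring.
Qed.

Lemma flat_laplacian_cst (a : R) z : flat_laplacian (fun=> a) z = 0.
Proof.
have e i : partial i (fun=> a) = fun=> 0 by apply/funext => x; exact: partial_cst.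
by rewrite /flat_laplacian !e !partial_cst addr0.
Qed.

Lemma flat_laplacianZ U (a : R) f z : open U -> smooth_on U f -> U z ->
  flat_laplacian (fun x => a * f x) z = a * flat_laplacian f z.
Proof.
move=> oU sf Uz; rewrite (flat_laplacianM oU (@smooth_cst _ _ a) sf Uz).
by rewrite flat_laplacian_cst /grad_dot !partial_cst !mul0r mulr0 !addr0 mulr0 addr0.
Qed.

Lemma flat_laplacian_sum U n (h : 'I_n -> plane -> R) z : open U ->
  (forall j, smooth_on U (h j)) -> U z ->
  flat_laplacian (fun x => \sum_j h j x) z = \sum_j flat_laplacian (h j) z.
Proof.
move=> oU + Uz; elim: n h => [|n IH] h sh.
  rewrite big_ord0 (flat_laplacian_ext (g := fun=> 0) oU)//.
    exact: flat_laplacian_cst.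
  by move=> x _; rewrite big_ord0.
have := flat_laplacianD oU (sh ord0) (smooth_sum oU (fun j => sh (lift ord0 j))) Uz.
rewrite (IH (fun j => h (lift ord0 j)))// big_ord_recl => <-.
by apply: (flat_laplacian_ext oU) => // x _; rewrite big_ord_recl.
Qed.

Lemma flat_laplacian_comp U (V : set R) (h h1 h2 : R -> R) f z : open U ->
  (forall t, V t -> is_derive t (1:R) h (h1 t)) ->
  (forall t, V t -> is_derive t (1:R) h1 (h2 t)) ->
  (forall x, U x -> V (f x)) -> smooth_on U f -> U z ->
  flat_laplacian (fun x => h (f x)) z =
  h2 (f z) * grad_dot f f z + h1 (f z) * flat_laplacian f z.
Proof.
move=> oU dh dh1 fV sf Uz.
have e i : partial i (partial i (fun x => h (f x))) z =
    h2 (f z) * (partial i f z * partial i f z) + h1 (f z) * partial i (partial i f) z.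
  rewrite (near_partial (g := fun x => h1 (f x) * partial i f x)); last first.
    apply: (open_near oU) => // x Ux.
    by apply: partial_comp; [exact: smooth_differentiable Ux|exact/dh/fV].
  have df := smooth_differentiable sf Uz.
  have dpf := smooth_partial_differentiable i sf Uz.
  have d1 := dh1 _ (fV _ Uz).
  rewrite partialM//; last exact: differentiable_comp1 df d1.
  rewrite (partial_comp i df d1).
  by move: (partial i (partial i f) z) (partial i f z) => a b; ring.
rewrite /flat_laplacian /grad_dot (e false) (e true).
by move: (partial false (partial false f) z) (partial true (partial true f) z)
  (partial false f z) (partial true f z) => a b c d; ring.
Qed.

End laplacian_calculus.

(** * Harmonic functions with logarithmic poles *)

Section log_distance.
Context {R : realType}.
Local Notation plane := (R * R)%type.
Implicit Types (z : plane) (s t : R).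

(* [lin_sq s t z] is |s z - t|^2; the point t / s of the sphere is oo if s = 0. *)
Definition lin_sq s t z : R := (s * z.1 - t) ^+ 2 + (s * z.2) ^+ 2.

(** log |s z - t|; it is constant for s = 0, so oo contributes no pole in the chart z. *)
Definition log_dist s t z : R := 2^-1 * ln (lin_sq s t z).

Lemma lin_sq_ge0 s t z : 0 <= lin_sq s t z.
Proof. by rewrite addr_ge0// sqr_ge0. Qed.

Lemma lin_sq_gt0 s t z : (0 < lin_sq s t z) = (lin_sq s t z != 0).
Proof. by rewrite lt_def lin_sq_ge0 andbT. Qed.

Lemma lin_sq_eq0 s t z : (lin_sq s t z == 0) = (s * z.1 == t) && (s * z.2 == 0).
Proof. by rewrite paddr_eq0 ?sqr_ge0// !sqrf_eq0 subr_eq0. Qed.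

Lemma smooth_lin_sq U s t : open U -> smooth_on U (lin_sq s t).
Proof.
move=> oU; apply: smoothD => //; apply: smoothX => //.
  apply: smoothB => //; last exact: smooth_cst.
  by apply: smoothM => //; [exact: smooth_cst|exact: smooth_fst].
by apply: smoothM => //; [exact: smooth_cst|exact: smooth_snd].
Qed.

Lemma continuous_lin_sq s t : continuous (lin_sq s t).
Proof.
by move=> z; apply/differentiable_continuous;
  exact: smooth_differentiable (@smooth_lin_sq setT s t openT) I.
Qed.

Lemma partial_lin_sq s t i z : partial i (lin_sq s t) z =
  if i then 2 * s ^+ 2 * z.2 else 2 * s * (s * z.1 - t).
Proof.
pose f1 (z : plane) : R := s * z.1 - t; pose f2 (z : plane) : R := s * z.2.
have ds1 x : differentiable (fun z : plane => s * z.1) x.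
  by apply: differentiableM; [exact: differentiable_cst|exact: differentiable_fst].
have d1 x : differentiable f1 x.
  by apply: differentiableB; [exact: ds1|exact: differentiable_cst].
have d2 x : differentiable f2 x.
  by apply: differentiableM; [exact: differentiable_cst|exact: differentiable_snd].
have p1 : partial i f1 z = s * (~~ i)%:R.
  rewrite (partialB i (ds1 z) (differentiable_cst t z)) partial_cst subr0.
  by rewrite (partialZ s i (differentiable_fst z)) partial_fst.
have p2 : partial i f2 z = s * i%:R.
  by rewrite (partialZ s i (differentiable_snd z)) partial_snd.
have -> : lin_sq s t = fun z => f1 z * f1 z + f2 z * f2 z.
  by apply/funext => x; rewrite /lin_sq !expr2.
rewrite (partialD i (differentiableM (d1 z) (d1 z)) (differentiableM (d2 z) (d2 z))).
rewrite (partialM i (d1 z) (d1 z)) (partialM i (d2 z) (d2 z)) p1 p2 /f1 /f2.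
by case: i {p1 p2}; rewrite /= ?mulr1 ?mulr0; ring.
Qed.

Lemma flat_laplacian_lin_sq s t z : flat_laplacian (lin_sq s t) z = 4 * s ^+ 2.
Proof.
have e0 : partial false (lin_sq s t) = fun z => 2 * s * (s * z.1 - t).
  by apply/funext => x; rewrite partial_lin_sq.
have e1 : partial true (lin_sq s t) = fun z => 2 * s ^+ 2 * z.2.
  by apply/funext => x; rewrite partial_lin_sq.
have ds1 : differentiable (fun z : plane => s * z.1) z.
  by apply: differentiableM; [exact: differentiable_cst|exact: differentiable_fst].
have h0 : partial false (fun z : plane => 2 * s * (s * z.1 - t)) z = 2 * s ^+ 2.
  rewrite (partialZ _ _ (differentiableB ds1 (differentiable_cst t z))).
  rewrite (partialB _ ds1 (differentiable_cst t z)) partial_cst subr0.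
  by rewrite (partialZ _ _ (differentiable_fst z)) partial_fst /= mulr1 -mulrA.
have h1 : partial true (fun z : plane => 2 * s ^+ 2 * z.2) z = 2 * s ^+ 2.
  by rewrite (partialZ _ _ (differentiable_snd z)) partial_snd mulr1.
by rewrite /flat_laplacian e0 e1 h0 h1; ring.
Qed.

Lemma smooth_log_dist U s t : open U -> (forall z, U z -> lin_sq s t z != 0) ->
  smooth_on U (log_dist s t).
Proof.
move=> oU U0; apply: smoothM => //; first exact: smooth_cst.
by apply: smooth_ln => // [|z /U0]; [exact: smooth_lin_sq|rewrite lin_sq_gt0].
Qed.

Lemma partial_log_dist s t i z : lin_sq s t z != 0 ->
  partial i (log_dist s t) z =
  (if i then s ^+ 2 * z.2 else s * (s * z.1 - t)) / lin_sq s t z.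
Proof.
move=> q0; have dq : differentiable (lin_sq s t) z.
  by exact: smooth_differentiable (@smooth_lin_sq setT s t openT) I.
have q1 : 0 < lin_sq s t z by rewrite lin_sq_gt0.
rewrite partialZ; last exact: differentiable_comp1 dq (is_derive1_ln q1).
rewrite (partial_comp i dq (is_derive1_ln q1)) partial_lin_sq.
by case: i; move: (lin_sq s t z) q0 => q q0; field.
Qed.

Lemma open_lin_sq_neq0 s t : open [set z : plane | lin_sq s t z != 0].
Proof.
rewrite (_ : [set z | _] = lin_sq s t @^-1` [set x | x != 0]); last by [].
by apply: open_comp; [move=> x _; exact: continuous_lin_sq|exact: open_neq].
Qed.

(** For q = |s z - t|^2 the Laplacian of ln q is (Delta q) / q - |grad q|^2 / q^2, where Delta q = 4
    s^2 and |grad q|^2 = 4 s^2 q. *)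
Lemma flat_laplacian_log_dist s t z : lin_sq s t z != 0 ->
  flat_laplacian (log_dist s t) z = 0.
Proof.
move=> q0; set U := [set z : plane | lin_sq s t z != 0].
have oU : open U by exact: open_lin_sq_neq0.
have Uz : U z by [].
have sl : smooth_on U (fun x => ln (lin_sq s t x)).
  by apply: smooth_ln => // [|x]; [exact: smooth_lin_sq|rewrite lin_sq_gt0].
rewrite (flat_laplacianZ _ oU sl Uz).
have dl (x : R) : 0 < x -> is_derive x (1:R) (@ln R) x^-1 by exact: is_derive1_ln.
have dl1 (x : R) : 0 < x -> is_derive x (1:R) (fun x => x^-1) (- x ^- 2).
  move=> x0; apply: is_derive_eq; first by apply: (is_deriveV (f := id)); rewrite /= gt_eqF.
  by rewrite /= /GRing.scale /= mulr1.
have Upos x : U x -> 0 < lin_sq s t x by rewrite lin_sq_gt0.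
rewrite (flat_laplacian_comp (V := [set x | 0 < x]) oU dl dl1 Upos (smooth_lin_sq s t oU) Uz).
rewrite flat_laplacian_lin_sq /grad_dot !partial_lin_sq.
(* Creates a copy of q in a numerator: that copy alone is expanded, while the denominators keep an
   abstract nonzero q. *)
rewrite (_ : 4 * s ^+ 2 = 4 * s ^+ 2 * lin_sq s t z / lin_sq s t z); last by rewrite mulfK.
rewrite {3}/lin_sq; move: (lin_sq s t z) q0 => q q0; field.
by [].
Qed.

End log_distance.

Section log_combination.
Context {R : realType} (k : nat) (s t : nat -> R).
Local Notation plane := (R * R)%type.
Implicit Types (w r m : nat -> R) (c : R).

Definition log_comb w (z : plane) : R := \sum_(i < k) w i * log_dist (s i) (t i) z.

Definition regular : set plane :=
  [set z | forall i : 'I_k, lin_sq (s i) (t i) z != 0].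

Lemma open_regular : open regular.
Proof.
rewrite openE => z Uz; rewrite /interior /=.
have H (i : 'I_k) : \forall x \near z, lin_sq (s i) (t i) x != 0.
  by apply: open_nbhs_nbhs; split; [exact: open_lin_sq_neq0|exact: Uz].
exact (@filter_forall _ _ (fun (i : 'I_k) x => lin_sq (s i) (t i) x != 0) (nbhs z) _ H).
Qed.

Lemma smooth_log_comb w : smooth_on regular (log_comb w).
Proof.
apply: smooth_sum => [|i]; first exact: open_regular.
apply: smoothM; [exact: open_regular|exact: smooth_cst|].
by apply: smooth_log_dist; [exact: open_regular|move=> z].
Qed.

Lemma flat_laplacian_log_comb w z : regular z -> flat_laplacian (log_comb w) z = 0.
Proof.
move=> Uz; have sd (i : 'I_k) : smooth_on regular (log_dist (s i) (t i)).
  by apply: smooth_log_dist; [exact: open_regular|move=> x].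
rewrite (flat_laplacian_sum open_regular (h := fun i z => w i * log_dist (s i) (t i) z))//.
  rewrite big1// => i _; rewrite (flat_laplacianZ _ open_regular (sd i) Uz).
  by rewrite flat_laplacian_log_dist ?mulr0.
by move=> j; apply: smoothM; [exact: open_regular|exact: smooth_cst|exact: sd].
Qed.

Lemma partial_log_comb w i z : regular z ->
  partial i (log_comb w) z = \sum_(j < k) w j *
   ((if i then s j ^+ 2 * z.2 else s j * (s j * z.1 - t j)) / lin_sq (s j) (t j) z).
Proof.
move=> Uz; have dd (j : 'I_k) : differentiable (log_dist (s j) (t j)) z.
  apply: smooth_differentiable Uz.
  by apply: smooth_log_dist; [exact: open_regular|move=> x].
rewrite (partial_sum (h := fun i z => w i * log_dist (s i) (t i) z)).
  by apply: eq_bigr => j _; rewrite partialZ// partial_log_dist.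
by move=> j; apply: differentiableM => //; exact: differentiable_cst.
Qed.

(* With phi = log_comb r and |omega| = c exp (log_comb m), this is the logarithm of
   |omega| / cosh phi; the condition |grad phi| = |omega| is [gradE] below. *)
Definition conf_log r m c z : R := ln c + log_comb m z - lncosh (log_comb r z).

Lemma smooth_conf_log r m c : smooth_on regular (conf_log r m c).
Proof.
have oU := open_regular; apply: smoothB => //; last first.
  by apply: smooth_lncosh => //; exact: smooth_log_comb.
by apply: smoothD => //; [exact: smooth_cst|exact: smooth_log_comb].
Qed.

Lemma expR_conf_log r m c z : 0 < c ->
  expR (2 * conf_log r m c z) =
  c ^+ 2 * expR (2 * log_comb m z) * (1 - th (log_comb r z) ^+ 2).
Proof.
move=> c0; rewrite -expR_lncosh /conf_log !mulrDr !expRD expRM_natl lnK ?posrE//.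
by rewrite mulrN.
Qed.

Section conformal.
Variables (r m : nat -> R) (c : R).
Hypothesis c0 : 0 < c.
Hypothesis gradE : forall z, regular z ->
  grad_dot (log_comb r) (log_comb r) z = c ^+ 2 * expR (2 * log_comb m z).

(** Liouville's equation. The logarithmic terms are harmonic, so only - log cosh phi contributes,
    namely - |grad phi|^2 / cosh^2 phi, and [gradE] turns this into - e^(2u). *)
Lemma flat_laplacian_conf_log z : regular z ->
  flat_laplacian (conf_log r m c) z = - expR (2 * conf_log r m c z).
Proof.
move=> Uz; have oU := open_regular.
have s1 := smooth_log_comb r; have s2 := smooth_log_comb m.
have slc : smooth_on regular (fun z => lncosh (log_comb r z)) by exact: smooth_lncosh.
rewrite /conf_log (flat_laplacian_ext (g := fun z => (ln c + log_comb m z) +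
  -1 * lncosh (log_comb r z)) oU _ Uz); last by move=> x _; rewrite mulN1r.
have scm : smooth_on regular (fun z => ln c + log_comb m z).
  by apply: smoothD => //; exact: smooth_cst.
rewrite (flat_laplacianD oU scm _ Uz); last by apply: smoothM => //; exact: smooth_cst.
rewrite (flat_laplacianD oU (@smooth_cst _ _ (ln c)) s2 Uz).
rewrite flat_laplacian_cst flat_laplacian_log_comb// (flat_laplacianZ _ oU slc Uz).
rewrite (flat_laplacian_comp (V := setT) oU (fun x _ => is_derive_lncosh x)
  (fun x _ => is_derive_th x) (fun _ _ => I) s1 Uz).
rewrite flat_laplacian_log_comb// gradE// -/(conf_log r m c z) expR_conf_log//.
by rewrite addr0 add0r mulr0 addr0 mulN1r (mulrC (1 - _)).
Qed.

(** From tanh'' = - 2 tanh (1 - tanh^2) and harmonicity of phi: the eigenvalue equation of the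
    height, with the area density moved to the right. *)
Lemma flat_laplacian_th_log z : regular z ->
  flat_laplacian (fun x => th (log_comb r x)) z =
  - (2 * th (log_comb r z) * expR (2 * conf_log r m c z)).
Proof.
move=> Uz; have oU := open_regular.
have dth (x : R) : is_derive x (1:R) (fun t => 1 - th t ^+ 2) (- (2 * th x * (1 - th x ^+ 2))).
  have h := is_deriveB (is_derive_cst (1:R) x 1) (is_deriveM (is_derive_th x) (is_derive_th x)).
  rewrite (_ : (fun t => _) = cst 1 - @th R * @th R); last first.
    by apply/funext => y; rewrite expr2.
  by apply: (is_derive_eq h); rewrite /GRing.scale /=; ring.
rewrite (flat_laplacian_comp (V := setT) oU (fun x _ => is_derive_th x)
  (fun x _ => dth x) (fun _ _ => I) (smooth_log_comb r) Uz).
rewrite flat_laplacian_log_comb// gradE// expR_conf_log//.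
by move: (th _) (expR _) => x y; ring.
Qed.

End conformal.

Lemma measurable_log_comb w : measurable_fun setT (log_comb w).
Proof.
have ml (j : nat) : measurable_fun setT (fun z => w j * log_dist (s j) (t j) z).
  apply: measurable_funM; first exact: measurable_cst.
  apply: measurable_funM; first exact: measurable_cst.
  apply: (measurableT_comp (f := @ln R)); first exact: measurable_ln.
  exact: (continuous_measurable_plane (@continuous_lin_sq _ _ _)).
rewrite /log_comb; elim: k => [|n IH].
  rewrite (_ : (fun z => _) = fun=> 0); first exact: measurable_cst.
  by apply/funext => z; rewrite big_ord0.
rewrite (_ : (fun z => _) = (fun z => \sum_(i < n) w i * log_dist (s i) (t i) z +
    w n * log_dist (s n) (t n) z)).
  exact: measurable_funD.
by apply/funext => z; rewrite big_ord_recr.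
Qed.

End log_combination.

(** * The metric in the two charts of the sphere *)

Section sphere_points.
Context {R : realType} (k : nat) (s t : nat -> R).
Local Notation plane := (R * R)%type.
Local Notation sphere := (sphere R).

Definition axis_point (i : nat) : sphere :=
  if s i == 0 then None else Some (t i / s i, 0).

Definition axis_points (i : 'I_k) : sphere := axis_point i.

(* The chart 1/z exchanges the homogeneous coordinates [s] and [t]. *)
Definition chart_s (b : bool) : nat -> R := if b then t else s.
Definition chart_t (b : bool) : nat -> R := if b then s else t.

Lemma sqn_ge0 (z : plane) : 0 <= sqn z.
Proof. by rewrite addr_ge0// sqr_ge0. Qed.

Lemma sqn_eq0 (z : plane) : (sqn z == 0) = (z == 0).
Proof. by rewrite /sqn paddr_eq0 ?sqr_ge0// !sqrf_eq0; case: z. Qed.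

Lemma lin_sq_inv (u w : R) (z : plane) : z != 0 ->
  lin_sq u w (z.1 / sqn z, - z.2 / sqn z) = lin_sq w u z / sqn z.
Proof.
rewrite -sqn_eq0 /lin_sq /sqn /=; move: z.1 z.2 => x y h; field.
by [].
Qed.

Hypothesis st0 : forall i, s i = 0 -> t i != 0.

Lemma chart_axis_point b z i :
  chart b z = axis_point i <-> lin_sq (chart_s b i) (chart_t b i) z = 0.
Proof.
have key (w : plane) : Some w = axis_point i <-> lin_sq (s i) (t i) w = 0.
  rewrite /axis_point; split=> [|/eqP].
    case: eqVneq => // si [->]; rewrite /lin_sq /=; apply/eqP.
    by rewrite mulr0 expr0n addr0 sqrf_eq0 mulrC divfK// subrr.
  rewrite lin_sq_eq0; case: (eqVneq (s i) 0) => [si|si /andP[/eqP e1]].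
    by rewrite si mul0r eq_sym (negbTE (st0 si)).
  rewrite mulf_eq0 (negbTE si) /= => /eqP w2; congr Some.
  by rewrite -e1 mulrC mulKf// -w2; case: w {e1 w2}.
case: b; rewrite /chart /=; last exact: key.
case: eqVneq => [->|z0].
  rewrite /axis_point /lin_sq /= !mulr0 sub0r sqrrN expr0n addr0; split=> [|/eqP].
    by case: eqVneq => // ->; rewrite expr0n.
  by rewrite sqrf_eq0 => ->.
split=> [/key|h]; first rewrite lin_sq_inv//.
  by move/eqP; rewrite mulf_eq0 invr_eq0 sqn_eq0 (negbTE z0) orbF => /eqP.
by apply/key; rewrite lin_sq_inv// h mul0r.
Qed.

Lemma chart_regular b z :
  ~ range axis_points (chart b z) <-> regular k (chart_s b) (chart_t b) z.
Proof.
split=> [h i|h [i _ /esym/chart_axis_point e]]; last first.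
  by move: (h i); rewrite e eqxx.
by apply/eqP => /chart_axis_point e; apply: h; exists i.
Qed.

Lemma chart_preimage b :
  chart b @^-1` (~` range axis_points) = regular k (chart_s b) (chart_t b).
Proof. by apply/seteqP; split=> z /chart_regular. Qed.

Hypothesis infinity_point : exists i : 'I_k, s i = 0.

(** Since oo is a marked point, the origin of the chart 1/z is never regular, and the inversion
    formulas apply to every regular point. *)
Lemma regular_chart_neq0 z : regular k (chart_s true) (chart_t true) z -> z != 0.
Proof.
case: infinity_point => i si /(_ i); apply: contraNneq => ->.
by rewrite lin_sq_eq0 /chart_s /chart_t /= !mulr0 si eqxx.
Qed.

(** From |u / z - w| = |w z - u| / |z|, every term loses log |z|, so the total weight governs the
    change of chart: weight 0 gives a function on the sphere, weight -2 the density of a one-form,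
    as |d(1/z)| = |z|^-2 |dz|. *)
Lemma log_comb_inv (w : nat -> R) z : regular k (chart_s true) (chart_t true) z ->
  log_comb k s t w (z.1 / sqn z, - z.2 / sqn z) =
  log_comb k t s w z - 2^-1 * (\sum_(i < k) w i) * ln (sqn z).
Proof.
move=> Uz; have z0 := regular_chart_neq0 Uz.
have n0 : 0 < sqn z by rewrite lt_def sqn_ge0 sqn_eq0 z0.
rewrite /log_comb mulr_sumr mulr_suml -sumrB; apply: eq_bigr => i _.
rewrite /log_dist lin_sq_inv// ln_div ?posrE// ?lin_sq_gt0; last exact: Uz.
by ring.
Qed.

Section metric.
Variables (r m : nat -> R) (c : R).
Hypothesis sum_r : \sum_(i < k) r i = 0.
Hypothesis sum_m : \sum_(i < k) m i = - 2.

(** The round factor is divided out so that [conf_exp] restores [conf_log]. The value at oo is a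
    placeholder at a marked point. *)
Definition cone_exp (x : sphere) : R :=
  if x is Some z then conf_log k s t r m c z - ln (2 / (1 + sqn z)) else 0.

Lemma conf_exp_cone b z : regular k (chart_s b) (chart_t b) z ->
  conf_exp cone_exp b z = conf_log k (chart_s b) (chart_t b) r m c z.
Proof.
case: b => Uz; rewrite /conf_exp /chart /=; last by rewrite subrK.
have z0 := regular_chart_neq0 Uz; rewrite (negbTE z0).
have n0 : 0 < sqn z by rewrite lt_def sqn_ge0 sqn_eq0 z0.
rewrite /cone_exp /conf_log !log_comb_inv// sum_r sum_m.
have -> : sqn (z.1 / sqn z, - z.2 / sqn z) = (sqn z)^-1.
  rewrite {1}/sqn /= !expr_div_n sqrrN -mulrDl -/(sqn z).
  by rewrite expr2 invfM mulrA divff ?mul1r// gt_eqF.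
have n1 : 0 < 1 + sqn z by rewrite ltr_wpDr// ltW.
have -> : 2 / (1 + (sqn z)^-1) = 2 / (1 + sqn z) * sqn z.
  move: (sqn z) n0 n1 => n n0 n1; field.
  by rewrite (gt_eqF n1) (gt_eqF n0).
rewrite lnM ?posrE ?divr_gt0//.
rewrite mulr0 mul0r subr0 /chart_s /chart_t.
by move: (ln (2 / _)) (ln (sqn z)) (log_comb _ _ _ _ _) (lncosh _) => *; field.
Qed.

Hypothesis c0 : 0 < c.
Hypothesis gradE : forall b z, regular k (chart_s b) (chart_t b) z ->
  let phi := log_comb k (chart_s b) (chart_t b) r in
  grad_dot phi phi z = c ^+ 2 * expR (2 * log_comb k (chart_s b) (chart_t b) m z).

Lemma smooth_sqn_ln U : open U -> smooth_on U (fun z : plane => ln (2 / (1 + sqn z))).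
Proof.
move=> oU.
have p0 (z : plane) : 0 < 1 + sqn z by rewrite ltr_wpDr// sqn_ge0.
apply: smooth_ln => // [|z _]; last by rewrite divr_gt0.
apply: smoothM => //; first exact: smooth_cst.
apply: smooth_inv => // [|z _]; last by rewrite gt_eqF.
apply: smoothD => //; first exact: smooth_cst.
by apply: smoothD => //; apply: smoothX => //; [exact: smooth_fst|exact: smooth_snd].
Qed.

Lemma smooth_cone_exp : smooth_sphere (~` range axis_points) cone_exp.
Proof.
move=> b; rewrite chart_preimage.
have oU : open (regular k (chart_s b) (chart_t b)) by exact: open_regular.
apply: (smooth_ext oU (f := fun z =>
   conf_log k (chart_s b) (chart_t b) r m c z - ln (2 / (1 + sqn z)))).
  by move=> z Uz; rewrite -conf_exp_cone// /conf_exp addrK.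
by apply: smoothB => //; [exact: smooth_conf_log|exact: smooth_sqn_ln].
Qed.

Lemma gauss_curvature_cone b z : ~ range axis_points (chart b z) ->
  gauss_curvature cone_exp b z = 1.
Proof.
move=> /chart_regular Uz; rewrite /gauss_curvature.
rewrite (flat_laplacian_ext (@open_regular _ _ _ _) (@conf_exp_cone b) Uz).
rewrite (flat_laplacian_conf_log c0 (gradE (b := b)) Uz) conf_exp_cone//.
by rewrite mulNr mulrNN mulrC expRxMexpNx_1.
Qed.

End metric.
End sphere_points.

(** * Cone points *)

Section asymptotics.
Context {R : realType} (X : Type) (F : set_system X) {FF : Filter F}.

(** The limit is written to cover w = 0 and w > 0 at once; it serves for w = |r| + r and w = |r| -
    r, of which at least one vanishes. *)
Lemma cvg_expR_Ny (lam : X -> R) (w : R) : lam x @[x --> F] --> -oo -> 0 <= w ->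
  expR (w * lam x) @[x --> F] --> ((w == 0)%:R : R).
Proof.
move=> lamNy; rewrite le_eqVlt eq_sym => /predU1P[->|w0].
  rewrite eqxx (_ : (fun x => _) = fun=> 1); first exact: cvg_cst.
  by apply/funext => x; rewrite mul0r expR0.
rewrite (gt_eqF w0); apply/cvgr0Pnorm_lt => e e0.
move/cvgrNyPlt : lamNy => /(_ (ln e / w)); apply: filterS => x.
rewrite ltr_pdivlMr// (ger0_norm (expR_ge0 _)) => h.
by rewrite -[ltRHS]lnK ?posrE// ltr_expR mulrC.
Qed.

(** Multiplying cosh (r lam + G) by exp (|r| lam) gives half the sum of exp ((|r| + r) lam + G) and
    exp ((|r| - r) lam - G). Both terms converge and one limit is positive, so the logarithm
    converges. *)
Lemma cvg_lncosh_Ny (lam G : X -> R) (r G0 : R) : lam x @[x --> F] --> -oo ->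
  G x @[x --> F] --> G0 ->
  exists l : R, lncosh (r * lam x + G x) + `|r| * lam x @[x --> F] --> l.
Proof.
move=> lamNy GG0.
have rp : 0 <= `|r| + r by rewrite -lerBlDr sub0r -normrN ler_norm.
have rm : 0 <= `|r| - r by rewrite subr_ge0 ler_norm.
pose L : R := ((`|r| + r == 0)%:R * expR G0 + (`|r| - r == 0)%:R * expR (- G0)) / 2.
have L0 : 0 < L.
  rewrite divr_gt0//; have [r0|r0] := leP 0 r.
    rewrite (ger0_norm r0) subrr eqxx mul1r ltr_wpDl ?expR_gt0// mulr_ge0// expR_ge0.
  by rewrite (ltr0_norm r0) addNr eqxx mul1r ltr_wpDr ?expR_gt0// mulr_ge0// expR_ge0.
exists (ln L).
rewrite (_ : (fun x => _) = fun x => ln ((expR ((`|r| + r) * lam x) * expR (G x) +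
    expR ((`|r| - r) * lam x) * expR (- G x)) / 2)); last first.
  apply/funext => x; rewrite /lncosh -[X in _ + X]expRK -lnM; last 2 first.
  - by rewrite posrE divr_gt0// cosh_gt0.
  - by rewrite posrE expR_gt0.
  congr ln; rewrite -!expRD mulrAC mulrDl -!expRD.
  by congr ((expR _ + expR _) / _); ring.
apply: (@continuous_cvg _ _ _ _ _ _ (@ln R)); first exact: (continuous_ln L0).
have cG : expR (G x) @[x --> F] --> expR G0.
  by apply: continuous_cvg => //; exact: continuous_expR.
have cGN : expR (- G x) @[x --> F] --> expR (- G0).
  by apply: continuous_cvg; [exact: continuous_expR|exact: cvgN].
by apply: cvgM; [apply: cvgD; apply: cvgM => //; exact: cvg_expR_Ny|exact: cvg_cst].
Qed.

End asymptotics.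

Section conic.
Context {R : realType}.
Local Notation plane := (R * R)%type.
Local Notation sphere := (sphere R).

Lemma continuous_sqn : continuous (@sqn R).
Proof.
rewrite (_ : @sqn R = lin_sq 1 0); first exact: continuous_lin_sq.
by apply/funext => z; rewrite /lin_sq /sqn !mul1r subr0.
Qed.

Lemma cvg_ln_sqn_Ny (z0 : plane) :
  2^-1 * ln (sqn (z - z0)) @[z --> z0^'] --> -oo.
Proof.
apply/cvgrNyPlt => A.
have c : sqn (z - z0) @[z --> z0] --> (0 : R).
  have -> : 0 = sqn (z0 - z0) :> R by rewrite subrr /sqn /= expr0n addr0.
  apply: (@continuous_cvg _ _ _ _ _ _ (@sqn R)); first exact: continuous_sqn.
  by apply: cvgB; [exact: cvg_id|exact: cvg_cst].
have /cvgr_lt /(_ (expR (2 * A)) (expR_gt0 _)) c1 := c.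
rewrite near_withinE; apply: filterS c1 => z h zz0.
have n0 : 0 < sqn (z - z0) by rewrite lt_def sqn_ge0 sqn_eq0 subr_eq0 zz0.
rewrite ltr_pdivrMl// -ltr_expR lnK ?posrE//.
Qed.

Lemma ln_enorm (z : plane) : ln (enorm z) = 2^-1 * ln (sqn z).
Proof.
have [->|z0] := eqVneq z 0; first by rewrite /enorm /sqn /= expr0n addr0 sqrtr0 ln0// mulr0.
have n0 : 0 < sqn z by rewrite lt_def sqn_ge0 sqn_eq0 z0.
rewrite -[in RHS](sqr_sqrtr (ltW n0)) lnXn ?sqrtr_gt0// -/(enorm z) -mulr_natl; lra.
Qed.

Variables (k : nat) (s t : nat -> R).
Hypothesis st0 : forall i, s i = 0 -> t i != 0.
Hypothesis infinity_point : exists i : 'I_k, s i = 0.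
Hypothesis points_inj : injective (axis_points (k := k) s t).
Variables (r m : nat -> R) (c : R).
Hypothesis sum_r : \sum_(i < k) r i = 0.
Hypothesis sum_m : \sum_(i < k) m i = - 2.

(** Near its point, [log_comb w] is w_i log |z - z0| plus a continuous function, and - log cosh phi
    behaves like |r_i| log |z - z0|. So a simple pole (m_i = -1) has parameter |r_i|, and a zero
    (r_i = 0) has 1 + m_i. *)
Lemma conic_cone (i : 'I_k) :
  conic_at (cone_exp k s t r m c) (axis_points s t i) (1 + (m i + `|r i|)).
Proof.
move=> b z0 hz0; rewrite addrC addKr.
set S := chart_s s t b; set T := chart_t s t b.
have H0 : lin_sq (S i) (T i) z0 = 0 by exact/chart_axis_point.
have Hj (j : 'I_k) : j != i -> lin_sq (S j) (T j) z0 != 0.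
  move=> /eqP ji; apply/eqP => /(chart_axis_point st0) e; apply: ji.
  by apply: points_inj; rewrite -hz0 e.
(* If [S i] vanished, [H0] would force [T i = 0] as well, which homogeneous coordinates exclude. *)
have Si : S i != 0.
  apply/eqP => Si; move: H0; rewrite /lin_sq Si !mul0r expr0n addr0 sub0r sqrrN => /eqP.
  rewrite sqrf_eq0; move: Si; rewrite /S /T /chart_s /chart_t; case: (b) => /=.
    by move=> ti /eqP/st0; rewrite ti eqxx.
  by move=> /st0/negbTE ->.
have qE z : lin_sq (S i) (T i) z = S i ^+ 2 * sqn (z - z0).
  move/eqP : H0; rewrite lin_sq_eq0 => /andP[/eqP e1].
  rewrite mulf_eq0 (negbTE Si) /= => /eqP e2.
  by rewrite /lin_sq /sqn -e1 /= e2 subr0; ring.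
pose kap : R := 2^-1 * ln (S i ^+ 2).
pose lam (z : plane) : R := 2^-1 * ln (sqn (z - z0)).
pose rest (w : nat -> R) (z : plane) : R :=
  \sum_(j < k | j != i) w j * log_dist (S j) (T j) z.
have restC w : rest w z @[z --> z0^'] --> rest w z0.
  apply: cvg_within_filter; apply: cvg_big => [|j ji]; first exact: add_continuous.
  apply: cvgM; first exact: cvg_cst.
  apply: cvgM; first exact: cvg_cst.
  apply: (@continuous_cvg _ _ _ _ _ _ (@ln R)); last exact: continuous_lin_sq.
  by apply: continuous_ln; rewrite lin_sq_gt0 Hj.
have combE w z : z != z0 -> log_comb k S T w z = w i * (kap + lam z) + rest w z.
  move=> zz0; rewrite /log_comb (bigD1 i)//=; congr (_ * _ + _).
  rewrite /log_dist qE lnM ?posrE; first by rewrite /kap /lam -mulrDr.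
    by rewrite exprn_even_gt0.
  by rewrite lt_def sqn_ge0 sqn_eq0 subr_eq0 zz0.
have cG : r i * kap + rest r z @[z --> z0^'] --> r i * kap + rest r z0.
  by apply: cvgD; [exact: cvg_cst|exact: restC].
have [l Hl] := cvg_lncosh_Ny (r i) (cvg_ln_sqn_Ny z0) cG.
exists (ln c + m i * kap + rest m z0 - l).
have reg : \forall z \near z0^', regular k S T z /\ z != z0.
  have near_ne : \forall z \near z0^', z != z0 by exact: nbhs_dnbhs_neq.
  have near_j : \forall z \near z0^', forall j : 'I_k, j != i -> lin_sq (S j) (T j) z != 0.
    apply: nbhs_dnbhs.
    have H (j : 'I_k) : \forall x \near z0, j != i -> lin_sq (S j) (T j) x != 0.
      have [->|ji] := eqVneq j i; first by near=> x.
      have : nbhs z0 [set x | lin_sq (S j) (T j) x != 0].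
        by apply: open_nbhs_nbhs; split; [exact: open_lin_sq_neq0|exact: Hj].
      by apply: filterS => x.
    exact (@filter_forall _ _ (fun (j : 'I_k) x => j != i -> lin_sq (S j) (T j) x != 0)
      (nbhs z0) _ H).
  near=> z; have zz0 : z != z0 by near: z.
  split=> // j; have [->|ji] := eqVneq j i; last by apply: (near near_j z).
  by rewrite qE mulf_neq0// ?sqrf_eq0// sqn_eq0 subr_eq0.
apply: (@cvg_trans _ (ln c + m i * kap + rest m z -
    (lncosh (r i * lam z + (r i * kap + rest r z)) + `|r i| * lam z) @[z --> z0^'])).
  apply: near_eq_cvg; near=> z.
  have [Uz zz0] : regular k S T z /\ z != z0 by near: z.
  rewrite conf_exp_cone// /conf_log !combE// ln_enorm -/(lam z).
  rewrite (_ : r i * (kap + lam z) + rest r z = r i * lam z + (r i * kap + rest r z)); last by ring.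
  by set Y := lncosh _; ring.
by apply: cvgB => //; apply: cvgD; [exact: cvg_cst|exact: restC].
Unshelve. all: by end_near. Qed.

End conic.

(** * Finiteness of the area *)

Lemma dominated_Rintegral_cvg0 d (T : measurableType d) (R : realType)
    (mu : {measure set T -> \bar R}) (f_ : nat -> T -> R) (g : T -> R) :
  (forall n, measurable_fun setT (f_ n)) ->
  (forall x, f_ n x @[n --> \oo] --> (0 : R)) ->
  mu.-integrable setT (EFin \o g) -> (forall n x, `|f_ n x| <= g x) ->
  Rintegral mu setT (f_ n) @[n --> \oo] --> (0 : R).
Proof.
move=> mf f0 ig fg.
have := @dominated_cvg _ _ _ mu setT measurableT (fun n => EFin \o f_ n) (cst 0%E) (EFin \o g).
move=> /(_ (fun n => (measurable_EFinP _ _).2 (mf n))) h.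
have h2 : (\int[mu]_x (f_ n x)%:E @[n --> \oo] --> 0%:E)%E.
  rewrite -[X in _ --> X](integral0 mu setT); apply: h => //.
    by move=> x _; apply: cvg_EFin; [near=> n|exact: f0].
  by move=> n x _; rewrite /= lee_fin.
exact: (fine_cvg h2).
Unshelve. all: by end_near. Qed.

Lemma integrable_prod_fun d1 d2 (T1 : measurableType d1) (T2 : measurableType d2)
    (R : realType) (m1 : {sigma_finite_measure set T1 -> \bar R})
    (m2 : {sigma_finite_measure set T2 -> \bar R}) (f : T1 -> R) (g : T2 -> R) :
  measurable_fun setT f -> measurable_fun setT g ->
  (forall x, 0 <= f x) -> (forall y, 0 <= g y) ->
  (\int[m1]_x (f x)%:E < +oo)%E -> (\int[m2]_y (g y)%:E < +oo)%E ->
  (m1 \x m2)%E.-integrable setT (EFin \o (fun z => f z.1 * g z.2)).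
Proof.
move=> mf mg f0 g0 fi gi.
have mfg : measurable_fun setT (fun z : T1 * T2 => f z.1 * g z.2).
  apply: measurable_funM.
    by apply: (measurableT_comp mf); exact: measurable_fst.
  by apply: (measurableT_comp mg); exact: measurable_snd.
have mfE : measurable_fun setT (fun x => (f x)%:E) by exact/measurable_EFinP.
have mgE : measurable_fun setT (fun x => (g x)%:E) by exact/measurable_EFinP.
apply/(integrable12ltyP _ _ ((measurable_EFinP _ _).2 mfg)).
have [I IE] : exists I : R, (\int[m2]_y (g y)%:E = I%:E)%E.
  exists (fine (\int[m2]_y (g y)%:E)); rewrite fineK// ge0_fin_numE//.
  by apply: integral_ge0 => x _; rewrite lee_fin.
rewrite (eq_integral (fun x => (f x)%:E * I%:E)%E); last first.
  move=> x _; rewrite -IE -ge0_integralZl//=.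
  - by apply: eq_integral => y _; rewrite ger0_norm ?EFinM// mulr_ge0.
  - by move=> y _; rewrite lee_fin.
  - by rewrite lee_fin.
rewrite ge0_integralZr//=.
- apply: lte_mul_pinfty; last exact: ltry.
    by apply: integral_ge0 => x _; rewrite lee_fin.
  by rewrite ge0_fin_numE//; apply: integral_ge0 => x _; rewrite lee_fin.
- by move=> y _; rewrite lee_fin.
- by rewrite -IE; apply: integral_ge0 => x _; rewrite lee_fin.
Qed.

Section cauchy_density.
Context {R : realType}.
Local Notation plane := (R * R)%type.

(** A product majorant of (1 + |z|^2)^-2, whose integral splits into two integrals of 1 / (1 +
    x^2). *)
Definition cauchy2 (z : plane) : R := (oneDsqr z.1)^-1 * (oneDsqr z.2)^-1.

Lemma integral_oneDsqr_lty :
  (\int[@lebesgue_measure R]_x ((oneDsqr x)^-1)%:E < +oo)%E.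
Proof.
rewrite ge0_symfun_integralT.
- by rewrite -set_itvcy integral0y_oneDsqr -EFinM ltry.
- by move=> x; rewrite invr_ge0 (le_trans _ (oneDsqr_ge1 x)).
- exact: continuous_oneDsqrV.
- by move=> x; rewrite /= /oneDsqr sqrrN.
Qed.

Lemma oneDsqrV_ge0 (x : R) : 0 <= (oneDsqr x)^-1.
Proof. by rewrite invr_ge0 (le_trans _ (oneDsqr_ge1 x)). Qed.

Lemma measurable_oneDsqrV : measurable_fun setT (fun x : R => (oneDsqr x)^-1).
Proof. by apply: continuous_measurable_fun; exact: continuous_oneDsqrV. Qed.

Lemma integrable_cauchy2 : integrable2 cauchy2.
Proof.
exact (@integrable_prod_fun _ _ _ _ R (@lebesgue_measure R) (@lebesgue_measure R) _ _
  measurable_oneDsqrV measurable_oneDsqrV oneDsqrV_ge0 oneDsqrV_ge0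
  integral_oneDsqr_lty integral_oneDsqr_lty).
Qed.

Lemma round_density_le (z : plane) : (1 + sqn z) ^- 2 <= cauchy2 z.
Proof.
have h (x : R) : 0 < oneDsqr x by rewrite (lt_le_trans _ (oneDsqr_ge1 x)).
have p1 : 0 < (1 + sqn z) ^+ 2 by rewrite exprn_gt0// ltr_wpDr// sqn_ge0.
have p2 : 0 < oneDsqr z.1 * oneDsqr z.2 by rewrite mulr_gt0.
rewrite /cauchy2 -invfM lef_pV2 ?posrE//.
rewrite /oneDsqr /sqn; have := sqr_ge0 z.1; have := sqr_ge0 z.2.
by move: (z.1 ^+ 2) (z.2 ^+ 2) => a b a0 b0; nra.
Qed.

End cauchy_density.

Section area.
Context {R : realType}.
Local Notation plane := (R * R)%type.
Local Notation sphere := (sphere R).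

Lemma compact_locally_bounded (T : topologicalType) (K : set T) (f : T -> R) :
  compact K -> (forall x, K x -> exists C, \forall y \near x, f y <= C) ->
  exists C, forall x, K x -> f x <= C.
Proof.
move=> /compact_near_coveringP/(_ R +oo (fun C x => f x <= C)) h loc.
have {h} : \forall C \near +oo, K `<=` [set x | f x <= C].
  apply: h => x /loc[C HC].
  exists ([set y | f y <= C], [set D | C <= D]); first split => //=.
    by exists C; split => [|D /ltW//]; exact: num_real.
  by move=> [y D] /= [/le_trans]; apply.
move=> [C [_ HC]]; exists (C + 1); apply: HC; by rewrite ltrDl.
Qed.

Variables (k : nat) (s t : nat -> R).
Hypothesis st0 : forall i, s i = 0 -> t i != 0.
Hypothesis infinity_point : exists i : 'I_k, s i = 0.
Hypothesis points_inj : injective (axis_points (k := k) s t).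
Variables (r m : nat -> R) (c : R).
Hypothesis sum_r : \sum_(i < k) r i = 0.
Hypothesis sum_m : \sum_(i < k) m i = - 2.
Hypothesis mr_ge0 : forall i : 'I_k, 0 <= m i + `|r i|.

Let v := cone_exp k s t r m c.

(** At a cone point the coefficient m_i + |r_i| of log |z - z0| is nonnegative and the logarithm is
    negative nearby, so the singular term only lowers the exponent. *)
Lemma conf_exp_locally_bounded b (z0 : plane) :
  exists C, \forall z \near z0, conf_exp v b z <= C.
Proof.
case: (pselect (range (axis_points (k := k) s t) (chart b z0))) => [[i _ /esym hz0]|].
  have [l Hl] := conic_cone st0 infinity_point points_inj c sum_r sum_m hz0.
  (* The limit controls a punctured neighbourhood only; the default value at [z0] is added by
     hand. *)
  exists (Num.max (conf_exp v b z0) (l + 1)).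
  have h1 : \forall z \near z0^', conf_exp v b z <= l + 1.
    have /cvgr_le /(_ (l + 1)) := Hl; rewrite ltrDl => /(_ ltr01) h.
    have h2 : \forall z \near z0^', ln (enorm (z - z0)) < 0.
      have /cvgrNyPlt /(_ 0) := cvg_ln_sqn_Ny z0.
      by apply: filterS => z; rewrite ln_enorm.
    near=> z; have a1 : ln (enorm (z - z0)) < 0 by near: z.
    have := mr_ge0 i.
    have : conf_exp v b z - (1 + (m i + `|r i|) - 1) * ln (enorm (z - z0)) <= l + 1.
      by near: z.
    rewrite [1 + _]addrC addrK => a2 a3.
    apply: le_trans a2; rewrite lerBrDr gerDl.
    by rewrite mulr_ge0_le0// ltW.
  move: h1; rewrite near_withinE; apply: filterS => z h.
  have [->|zz0] := eqVneq z z0; first by rewrite le_max lexx.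
  by rewrite le_max h ?orbT.
move=> /(chart_regular k st0) Uz.
exists (conf_log k (chart_s s t b) (chart_t s t b) r m c z0 + 1).
have oU : open (regular k (chart_s s t b) (chart_t s t b)) by exact: open_regular.
have dC := smooth_differentiable (@smooth_conf_log _ k (chart_s s t b) (chart_t s t b) r m c) Uz.
have /cvgr_le := differentiable_continuous dC.
move/(_ (conf_log k (chart_s s t b) (chart_t s t b) r m c z0 + 1)).
rewrite ltrDl => /(_ ltr01) n1.
have n2 : \forall z \near z0, regular k (chart_s s t b) (chart_t s t b) z.
  by apply: open_nbhs_nbhs; split; [exact: oU|exact: Uz].
by apply: filterS2 n1 n2 => z h Uz'; rewrite conf_exp_cone.
Unshelve. all: by end_near. Qed.

Lemma sqn_le_square (z : plane) : square 0 0 1 z -> sqn z <= 2.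
Proof.
case; rewrite /= !in_itv /= !sub0r !add0r -!ler_norml => h1 h2.
rewrite /sqn -real_normK ?num_real// -[z.2 ^+ 2]real_normK ?num_real//.
have h1' : `|z.1| ^+ 2 <= 1 by rewrite expr_le1.
have h2' : `|z.2| ^+ 2 <= 1 by rewrite expr_le1.
by lra.
Qed.

(** The closed unit squares of the two charts cover the sphere: off the first, |z| > 1, so 1 / z
    lies in the second. Each square is compact. *)
Lemma cone_exp_bounded : exists C, forall z : plane, v (Some z) <= C.
Proof.
have ck : compact (square 0 0 1 : set plane).
  by apply: compact_setX; exact: segment_compact.
have [C0 H0] := compact_locally_bounded ck (fun z _ => conf_exp_locally_bounded false z).
have [C1 H1] := compact_locally_bounded ck (fun z _ => conf_exp_locally_bounded true z).
(* On the unit square |z|^2 <= 2, hence the round factor 2 / (1 + |z|^2) is at least 2 / 3. *)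
have key b C z : square 0 0 1 z -> conf_exp v b z <= C -> v (chart b z) <= C - ln (2 / 3).
  move=> /sqn_le_square z2; rewrite /conf_exp -lerBrDr => /le_trans; apply.
  rewrite lerD2l lerN2 ler_ln ?posrE ?divr_gt0//; last by rewrite ltr_wpDr// sqn_ge0.
  rewrite ler_pM2l// lef_pV2 ?posrE//; first by rewrite -lerBrDl; apply: le_trans z2 _; lra.
  by rewrite ltr_wpDr// sqn_ge0.
exists (Num.max (C0 - ln (2 / 3)) (C1 - ln (2 / 3))) => z.
case: (pselect (square 0 0 1 z)) => hz.
  by rewrite le_max (key false C0 z hz (H0 _ hz)).
pose w : plane := (z.1 / sqn z, - z.2 / sqn z).
have z1 : 1 < `|z.1| \/ 1 < `|z.2|.
  apply: contrapT => /not_orP[/negP + /negP]; rewrite -!leNgt => h1 h2; apply: hz.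
  by split; rewrite /= in_itv /= sub0r add0r -ler_norml.
have sq1 (x : R) : `|x| ^+ 2 = x ^+ 2 by rewrite real_normK ?num_real.
have n1 : 1 < sqn z.
  rewrite /sqn -(sq1 z.1) -(sq1 z.2); have := sqr_ge0 `|z.1|; have := sqr_ge0 `|z.2|.
  by case: z1; nra.
have n0 : 0 < sqn z by rewrite (lt_trans _ n1).
have nw : sqn w = (sqn z)^-1.
  rewrite {1}/sqn /= !expr_div_n sqrrN -mulrDl -/(sqn z).
  by rewrite expr2 invfM mulrA divff ?mul1r// gt_eqF.
have w0 : w != 0 by rewrite -sqn_eq0 nw invr_eq0 gt_eqF.
have -> : Some z = chart true w.
  rewrite /chart /= (negbTE w0) nw; congr Some; rewrite /w /= invrK !mulNr opprK.
  by rewrite !divfK ?gt_eqF//; case: (z).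
have hw : square 0 0 1 w.
  have : sqn w <= 1 by rewrite nw invf_le1// ltW.
  rewrite /sqn -(sq1 w.1) -(sq1 w.2) => h.
  have h1 := sqr_ge0 `|w.1|; have h2 := sqr_ge0 `|w.2|.
  by split; rewrite /= in_itv /= sub0r add0r -ler_norml -(@expr_le1 _ 2)//; lra.
by rewrite le_max (key true C1 w hw (H1 _ hw)) orbT.
Qed.

Lemma measurable_conf_exp : measurable_fun setT (conf_exp v false).
Proof.
rewrite (_ : conf_exp v false = conf_log k s t r m c); last first.
  by apply/funext => z; rewrite /conf_exp /= subrK.
apply: measurable_funB.
  by apply: measurable_funD; [exact: measurable_cst|exact: measurable_log_comb].
apply: (measurableT_comp (f := @lncosh R)); last exact: measurable_log_comb.
by apply: continuous_measurable_fun; exact: continuous_lncosh.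
Qed.

Lemma measurable_area_density : measurable_fun setT (area_density v).
Proof.
apply: (measurableT_comp (f := @expR R)); first exact: measurable_expR.
by apply: measurable_funM; [exact: measurable_cst|exact: measurable_conf_exp].
Qed.

Lemma area_density_ge0 z : 0 <= area_density v z.
Proof. exact: expR_ge0. Qed.

Lemma integrable_area_density : integrable2 (area_density v).
Proof.
have [C HC] := cone_exp_bounded.
apply: (@le_integrable2 _ _ (fun z => (expR (2 * C) * 4) * cauchy2 z)).
- exact: measurable_area_density.
- move=> z; rewrite ger0_norm ?area_density_ge0// /area_density /conf_exp mulrDr expRD.
  have n0 : 0 < 1 + sqn z by rewrite ltr_wpDr// sqn_ge0.
  rewrite -mulrA ler_pM ?expR_ge0//; first by rewrite ler_expR ler_pM2l//; exact: HC.
  rewrite expRM_natl lnK ?posrE ?divr_gt0// expr_div_n.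
  have -> : 2 ^+ 2 = 4 :> R by ring.
  by rewrite ler_pM2l//; exact: round_density_le.
- exact: integrable2Z integrable_cauchy2.
Qed.

End area.

(** * The Dirichlet form *)

Section supported.
Context {R : realType}.
Local Notation plane := (R * R)%type.
Variable U : set plane.
Hypothesis oU : open U.
Implicit Types (f g h : plane -> R) (z : plane) (i : bool).

(** Compact support inside [U], in local form: vanishing near each point off [U] lets products with
    functions that are smooth only on [U] be treated as smooth on the whole plane. *)
Definition supported f :=
  (exists M : R, forall z, M < `|z| -> f z = 0) /\
  (forall z, ~ U z -> \near z, f z = 0).

Lemma supportedMl f g : supported g -> supported (fun z => f z * g z).
Proof.
move=> [[M HM] Hn]; split; first by exists M => z /HM ->; rewrite mulr0.
by move=> z /Hn; apply: filterS => x ->; rewrite mulr0.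
Qed.

Lemma supportedMr f g : supported f -> supported (fun z => f z * g z).
Proof.
move=> [[M HM] Hn]; split; first by exists M => z /HM ->; rewrite mul0r.
by move=> z /Hn; apply: filterS => x ->; rewrite mul0r.
Qed.

Lemma supportedB f g : supported f -> supported g -> supported (fun z => f z - g z).
Proof.
move=> [[M HM] Hn] [[N HN] Hn']; split.
  exists (Num.max M N) => z; rewrite gt_max => /andP[/HM -> /HN ->].
  by rewrite subr0.
by move=> z Uz; apply: filterS2 (Hn z Uz) (Hn' z Uz) => x -> ->; rewrite subr0.
Qed.

Lemma supported_partial i f : supported f -> supported (partial i f).
Proof.
move=> [[M HM] Hn]; split; first by exists M; exact: partial_eq0.
move=> z /Hn /near_join; apply: filterS => x fx.
by rewrite (near_partial (g := fun=> 0)) ?partial_cst.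
Qed.

Lemma supported_differentiable f : smooth_on U f -> supported f ->
  forall z, differentiable f z.
Proof.
move=> sf [_ Hn] z; have [Uz|nUz] := pselect (U z).
  exact: smooth_differentiable Uz.
apply: (near_differentiable (f := fun=> 0)); last exact: differentiable_cst.
by apply: filterS (Hn z nUz) => x ->.
Qed.

Lemma supported_continuous f : (forall z, U z -> {for z, continuous f}) ->
  supported f -> continuous f.
Proof.
move=> sf [_ Hn] z; have [Uz|nUz] := pselect (U z); first exact: sf.
apply: differentiable_continuous.
apply: (near_differentiable (f := fun=> 0)); last exact: differentiable_cst.
by apply: filterS (Hn z nUz) => x ->.
Qed.

Lemma supported_integrable f : (forall z, U z -> {for z, continuous f}) ->
  supported f -> integrable2 f.
Proof.
move=> cf sf; have [[M HM] _] := sf.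
by apply: integrable2_compact HM; exact: supported_continuous.
Qed.

Lemma smooth_continuous f z : smooth_on U f -> U z -> {for z, continuous f}.
Proof. by move=> sf Uz; apply: differentiable_continuous; exact: smooth_differentiable Uz. Qed.

Lemma supported_divergence i f : smooth_on U f -> supported f ->
  integrable2 (partial i f) /\ integral2 (partial i f) = 0.
Proof.
move=> sf suppf; have [[M HM] _] := suppf.
apply: divergence_theorem HM; first exact: supported_differentiable.
apply: supported_continuous; last exact: supported_partial.
by move=> z; apply: smooth_continuous; exact: smooth_partial.
Qed.

Lemma supported_flat_laplacian0 f z : supported f -> ~ U z -> flat_laplacian f z = 0.
Proof.
move=> sf nUz; have e i : partial i (partial i f) z = 0.
  have [_ /(_ z nUz)] := supported_partial i (supported_partial i sf).
  exact: nbhs_singleton.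
by rewrite /flat_laplacian (e false) (e true) addr0.
Qed.

Lemma supported_eq0 f z : supported f -> ~ U z -> f z = 0.
Proof. by move=> [_ Hn] /Hn; exact: nbhs_singleton. Qed.

Section eigenfunction.
Variables (F D : plane -> R).
Hypothesis sF : smooth_on U F.
Hypothesis cD : forall z, U z -> {for z, continuous D}.
Hypothesis lapF : forall z, U z -> flat_laplacian F z = - (2 * F z * D z).

(** Green's second identity: the field F grad g - g grad F is compactly supported in [U] and has
    divergence F Delta g - g Delta F. *)
Lemma green_eigenfunction g : smooth_on U g -> supported g ->
  integral2 (fun z => F z * - flat_laplacian g z) =
  integral2 (fun z => 2 * F z * g z * D z).
Proof.
move=> sg suppg.
pose G i z := F z * partial i g z - g z * partial i F z.
have sG i : smooth_on U (G i).
  by apply: smoothB => //; apply: smoothM => //; exact: smooth_partial.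
have suppG i : supported (G i).
  apply: supportedB; first by apply: supportedMl; exact: supported_partial.
  exact: supportedMr.
have [i0 e0] := supported_divergence false (sG false) (suppG false).
have [i1 e1] := supported_divergence true (sG true) (suppG true).
have dG i z : U z -> partial i (G i) z =
    F z * partial i (partial i g) z - g z * partial i (partial i F) z.
  move=> Uz; have dF := smooth_differentiable sF Uz; have dg := smooth_differentiable sg Uz.
  have dpF := smooth_partial_differentiable i sF Uz.
  have dpg := smooth_partial_differentiable i sg Uz.
  rewrite /G (partialB i (differentiableM dF dpg) (differentiableM dg dpF)).
  rewrite (partialM i dF dpg) (partialM i dg dpF).
  by move: (partial i (partial i g) z) (partial i (partial i F) z)
    (partial i g z) (partial i F z) => a b a' b'; ring.
have i2 : integrable2 (fun z => 2 * F z * g z * D z).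
  apply: supported_integrable; last by apply: supportedMr; exact: supportedMl.
  move=> z Uz; apply: cvgM; last exact: cD.
  apply: cvgM; last exact: (smooth_continuous sg Uz).
  by apply: cvgM; [exact: cvg_cst|exact: (smooth_continuous sF Uz)].
have e : (fun z => F z * - flat_laplacian g z) = (fun z => 2 * F z * g z * D z -
    (partial false (G false) z + partial true (G true) z)).
  apply/funext => z; have [Uz|nUz] := pselect (U z); last first.
    rewrite (supported_flat_laplacian0 suppg nUz) (supported_eq0 suppg nUz).
    have p0 i := supported_eq0 (supported_partial i (suppG i)) nUz.
    by rewrite (p0 false) (p0 true) oppr0 !mulr0 mul0r addr0 subr0.
  rewrite !dG//; have := lapF Uz; rewrite /flat_laplacian.
  move: (partial false (partial false g) z) (partial true (partial true g) z)
    (partial false (partial false F) z) (partial true (partial true F) z).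
  move=> a b a' b' h; have -> : a' = - (2 * F z * D z) - b' by rewrite -h addrK.
  by ring.
have e01 : integral2 (fun z => partial false (G false) z + partial true (G true) z) = 0.
  exact (etrans (integral2D i0 i1) (etrans (congr2 +%R e0 e1) (addr0 0))).
apply: (etrans (congr1 integral2 e)).
apply: (etrans (integral2B i2 (integrable2D i0 i1))).
exact (etrans (congr2 (fun a b => a - b) erefl e01) (subr0 _)).
Qed.

(* If -div grad F = 2 F D, then -F g div grad (F g) differs from
   2 (F g)^2 D + F^2 |grad g|^2 by the divergence of F^2 g grad g. *)
Lemma energy_eigenfunction g : smooth_on U g -> supported g ->
  let q z := F z ^+ 2 * grad_dot g g z in
  [/\ integrable2 (fun z => 2 * (F z * g z) ^+ 2 * D z), integrable2 q &
  integral2 (fun z => - flat_laplacian (fun x => F x * g x) z * (F z * g z)) =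
  integral2 (fun z => 2 * (F z * g z) ^+ 2 * D z) + integral2 q].
Proof.
move=> sg suppg q.
pose G i z := F z * F z * g z * partial i g z.
have sG i : smooth_on U (G i).
  apply: smoothM => //; last exact: smooth_partial.
  by apply: smoothM => //; exact: smoothM.
have suppG i : supported (G i) by apply: supportedMl; exact: supported_partial.
have [i0 e0] := supported_divergence false (sG false) (suppG false).
have [i1 e1] := supported_divergence true (sG true) (suppG true).
have dG i z : U z -> partial i (G i) z =
    F z ^+ 2 * g z * partial i (partial i g) z +
    F z ^+ 2 * (partial i g z * partial i g z) +
    2 * F z * g z * (partial i F z * partial i g z).
  move=> Uz; have dF := smooth_differentiable sF Uz; have dg := smooth_differentiable sg Uz.
  have dpF := smooth_partial_differentiable i sF Uz.
  have dpg := smooth_partial_differentiable i sg Uz.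
  rewrite /G (partialM i (differentiableM (differentiableM dF dF) dg) dpg).
  rewrite (partialM i (differentiableM dF dF) dg) (partialM i dF dF).
  have E1 : (F * F * g) z = F z * F z * g z by [].
  have E2 : (F * F) z = F z * F z by [].
  rewrite E1 E2.
  by move: (partial i (partial i g) z) (partial i g z) (partial i F z) => a b b'; ring.
have i2 : integrable2 (fun z => 2 * (F z * g z) ^+ 2 * D z).
  apply: supported_integrable; last first.
    apply: supportedMr; apply: supportedMl.
    have h : supported (fun z => F z * g z * (F z * g z)).
      by apply: supportedMl; exact: supportedMl.
    by rewrite (_ : (fun z => _) = fun z => F z * g z * (F z * g z)).
  move=> z Uz; apply: cvgM; last exact: cD.
  apply: cvgM; first exact: cvg_cst.
  rewrite expr2 (_ : (fun z => _) = fun z => F z * g z * (F z * g z)) //.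
  have h : F x * g x @[x --> z] --> F z * g z.
    by apply: cvgM; [exact: (smooth_continuous sF Uz)|exact: (smooth_continuous sg Uz)].
  exact: cvgM.
have i3 : integrable2 q.
  have cp i z : U z -> partial i g x @[x --> z] --> partial i g z.
    by move=> Uz; exact: (smooth_continuous (smooth_partial i sg) Uz).
  apply: supported_integrable.
    move=> z Uz; apply: cvgM.
      by apply: cvgM; exact: (smooth_continuous sF Uz).
    by apply: cvgD; apply: cvgM; exact: cp.
  apply: supportedMl.
  have h i : supported (fun z => partial i g z * partial i g z).
    by apply: supportedMl; exact: supported_partial.
  have [[M HM] Hn] := h false; have [[N HN] Hn'] := h true; split.
    exists (Num.max M N) => z; rewrite gt_max => /andP[/HM + /HN].
    by rewrite /grad_dot => -> ->; rewrite addr0.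
  move=> z Uz; apply: filterS2 (Hn z Uz) (Hn' z Uz) => x.
  by rewrite /grad_dot => -> ->; rewrite addr0.
split=> //.
have e : (fun z => - flat_laplacian (fun x => F x * g x) z * (F z * g z)) =
    (fun z => (2 * (F z * g z) ^+ 2 * D z + q z) -
    (partial false (G false) z + partial true (G true) z)).
  apply/funext => z; have [Uz|nUz] := pselect (U z); last first.
    rewrite /q /grad_dot (supported_eq0 suppg nUz).
    have p0 i := supported_eq0 (supported_partial i (suppG i)) nUz.
    have p1 i := supported_eq0 (supported_partial i suppg) nUz.
    rewrite (p0 false) (p0 true) (p1 false) (p1 true).
    by move: (flat_laplacian _ z) => L; ring.
  rewrite !dG// (flat_laplacianM oU sF sg Uz) lapF// /q /grad_dot /flat_laplacian.
  move: (partial false (partial false g) z) (partial true (partial true g) z)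
    (partial false F z) (partial true F z) (partial false g z) (partial true g z).
  by move=> a b c d c' d'; ring.
have e01 : integral2 (fun z => partial false (G false) z + partial true (G true) z) = 0.
  exact (etrans (integral2D i0 i1) (etrans (congr2 +%R e0 e1) (addr0 0))).
apply: (etrans (congr1 integral2 e)).
apply: (etrans (integral2B (integrable2D i2 i3) (integrable2D i0 i1))).
exact (etrans (congr2 (fun a b => a - b) (integral2D i2 i3) e01) (subr0 _)).
Qed.

End eigenfunction.

End supported.

Lemma sqr_sum_le (R : realFieldType) (n : nat) (x : 'I_n -> R) :
  (\sum_i x i) ^+ 2 <= n%:R * \sum_i x i ^+ 2.
Proof.
elim: n x => [|n IH] x; first by rewrite !big_ord0 expr0n mul0r.
rewrite !big_ord_recr /=; have := IH (fun i => x (widen_ord (leqnSn n) i)).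
case: n {IH} x => [|n] x; first by rewrite !big_ord0 !add0r mul1r.
move: (\sum_(i < _) _) (\sum_(i < _) _) (x ord_max) => Q S y SQ.
have n0 : 0 < n.+1%:R :> R by rewrite ltr0n.
rewrite -(ler_pM2l n0) -(natr1 n.+1); move: (n.+1%:R) n0 SQ => N n0 SQ.
by have := sqr_ge0 (S - N * y); nra.
Qed.

Lemma norm_le_of_sqr (R : realDomainType) (x e : R) : 0 <= e ->
  x ^+ 2 <= e ^+ 2 -> `|x| <= e.
Proof.
by move=> e0; rewrite -[x ^+ 2]real_normK ?num_real// ler_sqr ?nnegrE.
Qed.

(** * Logarithmic cutoffs of small energy *)

Section annuli.
Context {R : realType}.
Local Notation plane := (R * R)%type.

(* Layer-cake majorant of s^2 / |s z - t|^2 on exp (-N) <= |s z - t| <= exp N. *)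
Definition annuli (N : nat) (s t : R) (z : plane) : R :=
  \sum_(i < N.*2) (s / expR (i%:R - N%:R)) ^+ 2 *
    \1_(square (t / s) 0 (expR (i.+1%:R - N%:R) / `|s|)) z.

(** One term suffices: an index with rho i <= x <= rho (i+1) contributes 1 / rho i, which is at
    least 1 / x. *)
Lemma inv_annuli (x : R) (N : nat) (rho : nat -> R) :
  (forall i, 0 < rho i) -> rho 0 <= x -> x <= rho N -> (0 < N)%N ->
  x^-1 <= \sum_(i < N) (rho i)^-1 * (x <= rho i.+1)%R%:R.
Proof.
move=> rho0 x0; have xp : 0 < x by exact: lt_le_trans x0.
elim: N => // N IH xN _; rewrite big_ord_recr /=.
have s0 : 0 <= \sum_(i < N) (rho i)^-1 * (x <= rho i.+1)%R%:R.
  by apply: sumr_ge0 => i _; rewrite mulr_ge0// invr_ge0 ltW.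
have [xN'|xN'] := leP x (rho N); last first.
  by rewrite xN mulr1 ler_wpDl// lef_pV2 ?posrE// ltW.
case: N {s0} IH xN xN' => [|N] IH xN xN'.
  by rewrite big_ord0 add0r xN mulr1 lef_pV2 ?posrE.
apply: (le_trans (IH xN' isT)); rewrite lerDl mulr_ge0// invr_ge0 ltW//.
Qed.

Lemma annuli_ge (N : nat) (s t : R) (z : plane) : (0 < N)%N -> s != 0 ->
  expR (- (2 * N%:R)) <= lin_sq s t z -> lin_sq s t z <= expR (2 * N%:R) ->
  s ^+ 2 / lin_sq s t z <= annuli N s t z.
Proof.
move=> N0 s0 h1 h2; pose rho (i : nat) : R := expR (i%:R - N%:R) ^+ 2.
have rho0 i : 0 < rho i by rewrite exprn_gt0// expR_gt0.
have r1 : rho 0%N <= lin_sq s t z.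
  by rewrite /rho -expRM_natl sub0r mulrN.
have r2 : lin_sq s t z <= rho N.*2.
  rewrite /rho -expRM_natl (_ : N.*2%:R - N%:R = N%:R)//.
  by rewrite -addnn natrD addrK.
have := inv_annuli rho0 r1 r2; rewrite double_gt0 => /(_ N0) h.
apply: (@le_trans _ _ (s ^+ 2 * (\sum_(i < N.*2) (rho i)^-1 * (lin_sq s t z <= rho i.+1)%R%:R))).
  by rewrite ler_wpM2l// sqr_ge0.
rewrite mulr_sumr /annuli; apply: ler_sum => i _.
rewrite mulrA (_ : s ^+ 2 / rho i = (s / expR (i%:R - N%:R)) ^+ 2); last by rewrite expr_div_n.
rewrite ler_wpM2l ?sqr_ge0//.
case: (leP (lin_sq s t z) (rho i.+1)) => [h3|_]; last by rewrite indicE ler0n.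
rewrite indicE mem_set//; have ns : 0 < `|s| by rewrite normr_gt0.
have e0 := expR_gt0 (i.+1%:R - N%:R : R).
have key (x : R) : (s * x) ^+ 2 <= rho i.+1 -> `|x| <= expR (i.+1%:R - N%:R) / `|s|.
  move=> h4; rewrite ler_pdivlMr// mulrC -normrM.
  by apply: norm_le_of_sqr h4; exact: ltW.
split; rewrite /= in_itv /=.
- rewrite -ler_distl; apply: key; apply: le_trans h3.
  rewrite mulrBr (mulrC s (t / s)) divfK// /lin_sq lerDl sqr_ge0//.
- rewrite sub0r add0r -ler_norml; apply: key; apply: le_trans h3.
  by rewrite /lin_sq lerDr sqr_ge0.
Qed.

Lemma annuli_ge0 N s t z : 0 <= annuli N s t z.
Proof. by apply: sumr_ge0 => i _; rewrite mulr_ge0 ?sqr_ge0. Qed.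

Lemma integrable_annuli N s t : integrable2 (annuli N s t).
Proof.
apply: integrable2_sum => i; apply: integrable2_square.
by rewrite divr_ge0// expR_ge0.
Qed.

(** Scale invariance: height (s / rho)^2 times the area 4 (e rho / |s|)^2 of the square is 4 e^2 at
    every scale rho, and there are 2 N scales. *)
Lemma integral_annuli N s t : integral2 (annuli N s t) <= 8 * expR 2 * N%:R.
Proof.
have p (i : 'I_N.*2) : 0 <= expR (i.+1%:R - N%:R) / `|s| by rewrite divr_ge0// expR_ge0.
rewrite /annuli integral2_sum; last by move=> i; exact: integrable2_square.
apply: (@le_trans _ _ (\sum_(i < N.*2) 4 * expR 2)); last first.
  rewrite sumr_const card_ord -[_ *+ N.*2]mulr_natr -addnn natrD.
  by rewrite le_eqVlt; apply/orP; left; apply/eqP; ring.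
apply: ler_sum => i _; rewrite integral2_square//.
have [->|s0] := eqVneq s 0; first by rewrite mul0r expr0n mul0r mulr_ge0// expR_ge0.
rewrite !expr_div_n real_normK ?num_real//.
rewrite (_ : expR (i.+1%:R - N%:R) ^+ 2 = expR 2 * expR (i%:R - N%:R) ^+ 2).
  have := expR_gt0 (i%:R - N%:R : R); move: (expR (i%:R - N%:R)) => x x0.
  rewrite le_eqVlt; apply/orP; left; apply/eqP; field.
  by rewrite s0 gt_eqF.
by rewrite -!expRM_natl -expRD -natr1; congr expR; ring.
Qed.

End annuli.

Section cutoff.
Context {R : realType} (k : nat) (s t : nat -> R).
Local Notation plane := (R * R)%type.
Local Notation U := (regular k s t).

(** Squares keep the sum smooth where a logarithm changes sign. It tends to infinity at each finite
    point, and at oo through the terms of the finite points. *)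
Definition logsq (z : plane) : R := \sum_(i < k) log_dist (s i) (t i) z ^+ 2.

(* A logarithmic cutoff: its Dirichlet energy is O(1 / N). The indicator is needed
   since [ln 0 = 0], so that [logsq] does not blow up at the points themselves. *)
Definition cutoff (N : nat) (z : plane) : R :=
  \1_U z * (expR 1 * bumpR (1 - logsq z / N%:R ^+ 2)).

Lemma logsq_ge0 z : 0 <= logsq z.
Proof. by apply: sumr_ge0 => i _; exact: sqr_ge0. Qed.

Lemma cutoff_ge0 N z : 0 <= cutoff N z.
Proof. by rewrite !mulr_ge0// ?expR_ge0// bump_ge0. Qed.

Lemma cutoff_le N z : cutoff N z <= \1_U z.
Proof.
rewrite /cutoff ler_piMr// (@le_trans _ _ (expR 1 * expR (- 1)))//.
  rewrite ler_wpM2l ?expR_ge0// bump_le// gerBl divr_ge0 ?logsq_ge0// sqr_ge0//.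
by rewrite expRxMexpNx_1.
Qed.

Lemma indic_regular z : U z -> \1_U z = 1 :> R.
Proof. by move=> Uz; rewrite indicE mem_set. Qed.

Lemma smooth_logsq V : open V -> V `<=` U -> smooth_on V logsq.
Proof.
move=> oV VU; apply: smooth_sum => // i; apply: smoothX => //.
by apply: smooth_log_dist => // z /VU.
Qed.

Lemma smooth_cutoff N : smooth_on U (cutoff N).
Proof.
have oU : open U by exact: open_regular.
apply: (smooth_ext oU (f := fun z => expR 1 * bumpR (1 - logsq z * (N%:R ^+ 2)^-1))).
  by move=> z Uz; rewrite /cutoff indic_regular// mul1r.
apply: smoothM => //; first exact: smooth_cst.
apply: smooth_bump => //; apply: smoothB => //; first exact: smooth_cst.
by apply: smoothM => //; [exact: smooth_logsq|exact: smooth_cst].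
Qed.

Lemma log_dist_lt (N : nat) z (i : 'I_k) : (0 < N)%N -> logsq z < N%:R ^+ 2 ->
  `|log_dist (s i) (t i) z| < N%:R.
Proof.
move=> N0 h; rewrite -ltr_sqr ?nnegrE// real_normK ?num_real//.
apply: le_lt_trans h; rewrite /logsq (bigD1 i)//= lerDl.
by apply: sumr_ge0 => j _; exact: sqr_ge0.
Qed.

Lemma log_dist_annulus (N : nat) z (i : 'I_k) : (0 < N)%N -> U z ->
  logsq z < N%:R ^+ 2 ->
  expR (- (2 * N%:R)) <= lin_sq (s i) (t i) z /\
  lin_sq (s i) (t i) z <= expR (2 * N%:R).
Proof.
move=> N0 Uz /(log_dist_lt i N0); rewrite /log_dist.
have q0 : 0 < lin_sq (s i) (t i) z by rewrite lin_sq_gt0.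
rewrite ltr_norml => /andP[h1 h2].
rewrite -[lin_sq _ _ _]lnK ?posrE// !ler_expR; lra.
Qed.

Lemma cutoff_neq0 (N : nat) z : (0 < N)%N -> cutoff N z != 0 ->
  U z /\ logsq z < N%:R ^+ 2.
Proof.
move=> N0; rewrite /cutoff !mulf_eq0 !negb_or => /and3P[h1 _ h2].
split; first by apply: contrapT => nU; move: h1; rewrite indicE memNset// eqxx.
rewrite ltNge; apply: contra h2 => h; rewrite bump_le0// subr_le0.
by rewrite ler_pdivlMr ?mul1r// exprn_gt0// ltr0n.
Qed.

(** Stated through the polynomials [lin_sq], continuous everywhere, so that closedness is immediate;
    [logsq] is not continuous at the points themselves. *)
Definition cutoff_supp (N : nat) : set plane :=
  [set z | forall i : 'I_k, expR (- (2 * N%:R)) <= lin_sq (s i) (t i) z /\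
  lin_sq (s i) (t i) z <= expR (2 * N%:R)].

Lemma cutoff_suppP (N : nat) z : (0 < N)%N -> ~ cutoff_supp N z -> cutoff N z = 0.
Proof.
move=> N0 nz; apply/eqP; apply: contrapT => /negP /(cutoff_neq0 N0)[Uz h].
by apply: nz => i; exact: log_dist_annulus.
Qed.

Lemma cutoff_supp_regular N : cutoff_supp N `<=` U.
Proof.
by move=> z h i; have [h1 _] := h i; rewrite gt_eqF// (lt_le_trans _ h1)// expR_gt0.
Qed.

Hypothesis finite_point : exists i : 'I_k, s i != 0.

Lemma cutoff_supp_bounded N : exists M : R, forall z, cutoff_supp N z -> `|z| <= M.
Proof.
have [i si] := finite_point; have ns : 0 < `|s i| by rewrite normr_gt0.
set E : R := expR N%:R.
have E0 : 0 < E by exact: expR_gt0.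
exists ((E + `|t i|) / `|s i|) => z /(_ i)[_]; rewrite expRM_natl -/E => h.
have key (x : R) : x ^+ 2 <= lin_sq (s i) (t i) z -> `|x| <= E.
  move=> /le_trans /(_ h) hx.
  by apply: norm_le_of_sqr hx; exact: ltW.
have h1 : `|s i * z.1 - t i| <= E by apply: key; rewrite /lin_sq lerDl sqr_ge0.
have h2 : `|s i * z.2| <= E by apply: key; rewrite /lin_sq lerDr sqr_ge0.
have -> : `|z| = Num.max `|z.1| `|z.2| by [].
rewrite ge_max !ler_pdivlMr// ![_ * `|s i|]mulrC -!normrM; apply/andP; split.
  by rewrite -[s i * z.1](subrK (t i)) (le_trans (ler_normD _ _))// lerD2r.
by apply: (le_trans h2); rewrite lerDl.
Qed.

Lemma compact_cutoff_supp N : compact (cutoff_supp N).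
Proof.
have [M HM] := cutoff_supp_bounded N.
have cM : compact (square 0 0 M : set plane).
  by apply: compact_setX; exact: segment_compact.
apply: subclosed_compact cM _; last first.
  move=> z /HM; rewrite [`|z|]/(Num.max `|z.1| `|z.2|) ge_max => /andP[h1 h2].
  by split; rewrite /= in_itv /= sub0r add0r -ler_norml.
rewrite (_ : cutoff_supp N = \bigcap_(i in [set: 'I_k])
    ((lin_sq (s i) (t i) @^-1` [set x | expR (- (2 * N%:R)) <= x]) `&`
     (lin_sq (s i) (t i) @^-1` [set x | x <= expR (2 * N%:R)]))).
  apply: closed_bigI => i _; apply: closedI; apply: closed_comp;
    by [move=> x _; exact: continuous_lin_sq|exact: closed_ge|exact: closed_le].
by apply/seteqP; split=> z h i; [move=> _; exact: h|exact: h].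
Qed.

Lemma supported_cutoff N : (0 < N)%N -> supported U (cutoff N).
Proof.
move=> N0; split.
  have [M HM] := cutoff_supp_bounded N; exists M => z hz.
  apply: cutoff_suppP => // /HM; by rewrite leNgt hz.
move=> z nUz.
have /existsNP[i /negP] : ~ (forall i : 'I_k, lin_sq (s i) (t i) z != 0) := nUz.
rewrite negbK => /eqP q0.
have := @continuous_lin_sq _ (s i) (t i) z => /cvgr_lt /(_ (expR (- (2 * N%:R)))).
rewrite q0 expR_gt0 => /(_ isT); apply: filterS => w hw.
by apply: cutoff_suppP => // /(_ i)[]; rewrite leNgt hw.
Qed.

(** The argument of the bump tends to 1, where its value exp (-1) cancels the normalising factor
    [expR 1]. *)
Lemma cutoff_cvg z : cutoff n.+1 z @[n --> \oo] --> (\1_U z : R).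
Proof.
rewrite -[X in _ --> X]mulr1 /cutoff; apply: cvgM; first exact: cvg_cst.
rewrite -[X in _ --> X](expRxMexpNx_1 (1:R)) -bump1; apply: cvgM; first exact: cvg_cst.
apply: (@continuous_cvg _ _ _ _ _ _ (@bumpR R)).
  by have [/derivable1_diffP/differentiable_continuous] := is_derive_bump (1 : R).
rewrite -[X in _ --> X](subr0 1); apply: cvgB; first exact: cvg_cst.
rewrite -[X in _ --> X](mulr0 (logsq z)); apply: cvgM; first exact: cvg_cst.
rewrite (_ : (fun n => _) = (fun n => (n.+1%:R : R)^-1 * n.+1%:R^-1)); last first.
  by apply/funext => n; rewrite expr2 invfM.
by rewrite -[X in _ --> X](mulr0 (0:R)); apply: cvgM; exact: cvg_harmonic.
Qed.

(** The constant is (4 e / N)^2 times the k of Cauchy-Schwarz. In the gradient of the cutoff,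
    [bumpR'] and the differentiated squares give 2 each, every log distance is below N, and the
    argument carries N^-2. *)
Definition energy_bound (N : nat) (z : plane) : R :=
  (16 * expR 1 ^+ 2 * k%:R / N%:R ^+ 2) * \sum_(i < k) annuli N (s i) (t i) z.

(** [bumpR'] vanishes unless logsq z < N^2, which puts |s z - t| between exp (-N) and exp N for
    every point; there each squared partial of log |s z - t| is at most s^2 / |s z - t|^2, which
    [annuli] dominates. *)
Lemma partial_cutoff_bound N i z : (0 < N)%N ->
  partial i (cutoff N) z ^+ 2 <= energy_bound N z.
Proof.
move=> N0; have Np : 0 < N%:R :> R by rewrite ltr0n.
have oU : open U by exact: open_regular.
have e0 : 0 <= energy_bound N z.
  apply: mulr_ge0; last by apply: sumr_ge0 => j _; exact: annuli_ge0.
  by rewrite !mulr_ge0 ?invr_ge0 ?sqr_ge0.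
have [Uz|nUz] := pselect (U z); last first.
  rewrite (supported_eq0 (supported_partial i (supported_cutoff N0)) nUz).
  by rewrite expr0n.
have dl (j : 'I_k) : differentiable (log_dist (s j) (t j)) z.
  by apply: smooth_differentiable Uz; apply: smooth_log_dist => // x.
pose A : R := - (N%:R ^+ 2)^-1.
have dW : differentiable logsq z.
  by apply: smooth_differentiable Uz; exact: smooth_logsq.
have pW : partial i logsq z =
    2 * \sum_(j < k) log_dist (s j) (t j) z * partial i (log_dist (s j) (t j)) z.
  rewrite (partial_sum (h := fun j z => log_dist (s j) (t j) z ^+ 2)); last first.
    by move=> j; rewrite (_ : (fun z => _) = (fun z => log_dist (s j) (t j) z * log_dist (s j) (t j) z));
      [exact: differentiableM|apply/funext => x; rewrite expr2].
  rewrite mulr_sumr; apply: eq_bigr => j _.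
  rewrite (_ : (fun z => _) = (fun z => log_dist (s j) (t j) z * log_dist (s j) (t j) z));
    last by apply/funext => x; rewrite expr2.
  by rewrite partialM//; move: (partial _ _ _) (log_dist _ _ _) => a b; ring.
have dA : differentiable (fun z => A * logsq z) z.
  by apply: differentiableM => //; exact: differentiable_cst.
have d1 : differentiable (fun z => 1 + A * logsq z) z.
  by apply: differentiableD => //; exact: differentiable_cst.
have p1 : partial i (fun z => 1 + A * logsq z) z = A * partial i logsq z.
  by rewrite (partialD i (differentiable_cst (1:R) z) dA) partial_cst add0r partialZ.
have pc : partial i (cutoff N) z =
    expR 1 * (bumpR' (1 + A * logsq z) * (A * partial i logsq z)).
  rewrite (near_partial (g := fun z => expR 1 * bumpR (1 + A * logsq z))); last first.
    apply: (open_near oU) => // x Ux; rewrite /cutoff indic_regular// mul1r.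
    by rewrite /A mulNr (mulrC _ (logsq x)).
  have db := is_derive_bump (1 + A * logsq z).
  rewrite (partialZ _ i (differentiable_comp1 d1 db)).
  by rewrite (partial_comp i d1 db) p1.
have [h|h] := leP (N%:R ^+ 2) (logsq z).
  rewrite pc bumpR'_le0 ?mul0r ?mulr0 ?expr0n//.
  by rewrite /A mulNr subr_le0 mulrC ler_pdivlMr ?mul1r// exprn_gt0.
pose S : R := \sum_(j < k) `|partial i (log_dist (s j) (t j)) z|.
have S0 : 0 <= S by apply: sumr_ge0.
have bW : `|partial i logsq z| <= 2 * (N%:R * S).
  rewrite pW normrM ger0_norm// ler_pM2l// (le_trans (ler_norm_sum _ _ _))//.
  rewrite /S mulr_sumr; apply: ler_sum => j _.
  by rewrite normrM ler_wpM2r// ltW// log_dist_lt.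
have bc : `|partial i (cutoff N) z| <= 4 * expR 1 / N%:R * S.
  rewrite pc !normrM (ger0_norm (expR_ge0 _)).
  have -> : 4 * expR 1 / N%:R * S = expR 1 * (2 * (`|A| * (2 * (N%:R * S)))).
    rewrite /A normrN normfV ger0_norm ?exprn_ge0//.
    by field; rewrite gt_eqF.
  rewrite ler_pM2l ?expR_gt0// ler_pM// ?mulr_ge0//; first exact: bumpR'_bound.
  by rewrite ler_wpM2l.
have bS : S ^+ 2 <= k%:R * \sum_(j < k) annuli N (s j) (t j) z.
  apply: (@le_trans _ _ (k%:R * \sum_(j < k) `|partial i (log_dist (s j) (t j)) z| ^+ 2)).
    exact: sqr_sum_le.
  rewrite ler_wpM2l//; apply: ler_sum => j _; rewrite real_normK ?num_real//.
  rewrite partial_log_dist; last exact: Uz.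
  have [sj|sj] := eqVneq (s j) 0.
    by rewrite sj expr0n /= !mul0r if_same mul0r expr0n annuli_ge0.
  have [a1 a2] := log_dist_annulus j N0 Uz h.
  apply: le_trans (annuli_ge N0 sj a1 a2).
  have q0 : 0 < lin_sq (s j) (t j) z by rewrite lin_sq_gt0.
  rewrite expr_div_n ler_pdivrMr ?exprn_gt0// expr2 mulrA divfK ?gt_eqF//.
  case: (i); rewrite /lin_sq.
    have -> : s j ^+ 2 * z.2 * (s j ^+ 2 * z.2) = s j ^+ 2 * (s j * z.2) ^+ 2 by ring.
    by rewrite ler_wpM2l ?sqr_ge0// lerDr sqr_ge0.
  rewrite -expr2 exprMn ler_wpM2l ?sqr_ge0// lerDl sqr_ge0//.
rewrite -real_normK ?num_real// /energy_bound.
apply: (@le_trans _ _ ((4 * expR 1 / N%:R * S) ^+ 2)).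
  by rewrite ler_sqr ?nnegrE// mulr_ge0// divr_ge0// mulr_ge0// expR_ge0.
rewrite exprMn; apply: (le_trans (ler_wpM2l (sqr_ge0 _) bS)).
move: (\sum_(j < k) annuli _ _ _ _) (expR 1) => X E.
by rewrite le_eqVlt; apply/orP; left; apply/eqP; field; rewrite gt_eqF.
Qed.

Lemma integrable_energy_bound N : integrable2 (energy_bound N).
Proof.
apply: integrable2Z; apply: (integrable2_sum (h := fun i => annuli N (s i) (t i))) => i.
exact: integrable_annuli.
Qed.

Lemma integral_energy_bound : exists C : R, forall N, (0 < N)%N ->
  integral2 (energy_bound N) <= C / N%:R.
Proof.
exists (16 * expR 1 ^+ 2 * k%:R * (k%:R * (8 * expR 2))) => N N0.
have Np : 0 < N%:R :> R by rewrite ltr0n.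
have ia (i : 'I_k) := integrable_annuli N (s i) (t i).
rewrite /energy_bound integral2Z; last first.
  exact: (integrable2_sum (h := fun i => annuli N (s i) (t i)) ia).
rewrite (integral2_sum (h := fun i => annuli N (s i) (t i)) ia).
apply: (@le_trans _ _ ((16 * expR 1 ^+ 2 * k%:R / N%:R ^+ 2) * (\sum_(i < k) 8 * expR 2 * N%:R))).
  apply: ler_wpM2l; first by rewrite !mulr_ge0 ?invr_ge0 ?sqr_ge0.
  by apply: ler_sum => i _; exact: integral_annuli.
rewrite sumr_const card_ord -mulr_natr le_eqVlt; apply/orP; left; apply/eqP.
by field; rewrite gt_eqF.
Qed.

End cutoff.

Section compact_in_sphere.
Context {R : realType}.
Local Notation plane := (R * R)%type.
Local Notation sphere := (sphere R).
Variable K : set sphere.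
Hypothesis cK : compact K.
Hypothesis KNone : ~ K None.

Lemma compact_sphere_bounded : exists M : R, forall z : plane, M < `|z| -> ~ K (Some z).
Proof.
have := (compact_near_coveringP K).1 cK R +oo (fun M x => forall z, x = Some z -> `|z| <= M).
have h : forall x, K x -> \forall x' \near x & M \near +oo,
    forall z : plane, x' = Some z -> `|z| <= M.
  move=> [y|//] _.
  exists (Some @` ball y 1, [set M | `|y| + 1 <= M]); first split => /=.
  - by apply: one_point_compactification_some_nbhs; exact: nbhsx_ballx.
  - by exists (`|y| + 1); split => [|M /ltW//]; exact: num_real.
  - move=> [x' M] /= [[w yw <-] yM] z [<-]; apply: le_trans yM.
    rewrite -[w](subrK y) (le_trans (ler_normD _ _))// addrC lerD2l distrC ltW//.
    by move: yw; rewrite -ball_normE.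
move=> /(_ _ h) [M [_ HM]]; exists (M + 1) => z Mz Kz.
have := HM (M + 1); rewrite ltrDl => /(_ ltr01 _ Kz z erefl).
by rewrite leNgt Mz.
Qed.

Lemma compact_sphere_separated (z : plane) : ~ K (Some z) -> \near z, ~ K (Some z).
Proof.
move=> nKz.
have := (compact_near_coveringP K).1 cK plane (nbhs z) (fun w x => x <> Some w).
have h : forall x, K x -> \forall x' \near x & w \near z, x' <> Some w.
  move=> [y|//] Ky.
  have yz : 0 < `|y - z| / 2.
    by rewrite divr_gt0// normr_gt0 subr_eq0; apply: contra_notN nKz => /eqP <-.
  exists (Some @` ball y (`|y - z| / 2), ball z (`|y - z| / 2)); first split => /=.
  - by apply: one_point_compactification_some_nbhs; exact: nbhsx_ballx.
  - exact: nbhsx_ballx.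
  - move=> [x' w] /= [[w' yw' <-] zw] [e]; move: yw' zw; rewrite e -!ball_normE /=.
    move=> h1 h2; have : `|y - z| < `|y - z|.
      rewrite -{1}(subrK w y) -addrA (le_lt_trans (ler_normD _ _))//.
      by rewrite (splitr `|y - z|) ltrD// distrC.
    by rewrite ltxx.
by move=> /(_ _ h); apply: filterS => w /(_ (Some w)) hw Kw; exact: (hw Kw).
Qed.

End compact_in_sphere.

Lemma weighted_sqr_sub_le (R : realDomainType) (p q d : R) : 0 <= d ->
  2 * (p - q) ^+ 2 * d <= 4 * (p ^+ 2 * d) + 4 * (q ^+ 2 * d).
Proof.
move=> d0; rewrite (mulrA 4) (mulrA 4 (q ^+ 2)) -mulrDl; apply: ler_wpM2r => //.
by have := sqr_ge0 (p + q); nra.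
Qed.

Lemma sixteenths_lt (R : realFieldType) (a b a' b' e : R) :
  a < e / 16 -> b < e / 16 -> a' < e / 16 -> b' < e / 16 ->
  4 * a + 4 * b + (4 * a' + 4 * b') < e.
Proof. lra. Qed.

(** * The eigenfunction in the Friedrichs domain *)

Section spectrum.
Context {R : realType}.
Local Notation plane := (R * R)%type.
Local Notation sphere := (sphere R).
Variables (k : nat) (s t : nat -> R).
Hypothesis st0 : forall i, s i = 0 -> t i != 0.
Hypothesis infinity_point : exists i : 'I_k, s i = 0.
Hypothesis finite_point : exists i : 'I_k, s i != 0.
Hypothesis points_inj : injective (axis_points (k := k) s t).
Variables (r m : nat -> R) (c : R).
Hypothesis sum_r : \sum_(i < k) r i = 0.
Hypothesis sum_m : \sum_(i < k) m i = - 2.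
Hypothesis mr_ge0 : forall i : 'I_k, 0 <= m i + `|r i|.
Hypothesis c0 : 0 < c.
Hypothesis gradE : forall z, regular k s t z ->
  grad_dot (log_comb k s t r) (log_comb k s t r) z =
  c ^+ 2 * expR (2 * log_comb k s t m z).

Let v := cone_exp k s t r m c.
Let P := range (axis_points (k := k) s t).
Let U := regular k s t.
Let F (z : plane) : R := th (log_comb k s t r z).
Let D (z : plane) : R := area_density v z.

Let oU : open U. Proof. exact: open_regular. Qed.

Let confE z : conf_exp v false z = conf_log k s t r m c z.
Proof. by rewrite /conf_exp /v /cone_exp /= subrK. Qed.

Let DE z : D z = expR (2 * conf_log k s t r m c z).
Proof. by rewrite /D /area_density confE. Qed.

Let sF : smooth_on U F.
Proof. by apply: smooth_th => //; exact: smooth_log_comb. Qed.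

Let cD z : U z -> {for z, continuous D}.
Proof.
move=> Uz; have -> : D = fun z => expR (2 * conf_log k s t r m c z).
  by apply/funext => x; exact: DE.
apply: (@smooth_continuous _ U) => //; apply: smooth_expR => //.
by apply: smoothM => //; [exact: smooth_cst|exact: smooth_conf_log].
Qed.

Let lapF z : U z -> flat_laplacian F z = - (2 * F z * D z).
Proof. by move=> Uz; rewrite /F (flat_laplacian_th_log c0 gradE Uz) DE. Qed.

Let PU z : ~ P (Some z) <-> U z.
Proof. by have := @chart_regular _ k s t st0 false z. Qed.

Let PNone : P None.
Proof.
have [i si] := infinity_point; exists i => //.
by rewrite /axis_points /axis_point si eqxx.
Qed.

Let mF : measurable_fun setT F.
Proof.
apply: (measurableT_comp (f := @th R)); last exact: measurable_log_comb.
by apply: continuous_measurable_fun; exact: continuous_th.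
Qed.

Let mD : measurable_fun setT D. Proof. exact: measurable_area_density. Qed.

Let D0 z : 0 <= D z. Proof. exact: expR_ge0. Qed.

Let iD : integrable2 D. Proof. exact: integrable_area_density. Qed.

Let F1 z : F z ^+ 2 <= 1.
Proof. by rewrite -real_normK ?num_real// expr_le1// th_lt1. Qed.

Let m1U : measurable_fun setT (\1_U : plane -> R).
Proof. by apply: measurable_indic; exact: open_measurable_plane. Qed.

(** The indicator resets the default values at the finitely many marked points, so that the
    truncations converge to it at every point. *)
Definition eigenfunction (x : sphere) : R :=
  if x is Some z then \1_U z * F z else 0.

Let f := eigenfunction.

Let fE z : f (Some z) = \1_U z * F z. Proof. by []. Qed.

Let f2E z : (2 *: f) (Some z) = 2 * (\1_U z * F z). Proof. by []. Qed.

Let mf : measurable_fun setT (f \o Some).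
Proof. exact: measurable_funM. Qed.

Lemma bounded_L2 (C : R) (h : sphere -> R) : measurable_fun setT (h \o Some : plane -> R) ->
  (forall z, h (Some z) ^+ 2 <= C) -> L2 v h.
Proof.
move=> mh hC; split=> //.
have : integrable2 (fun z => h (Some z) ^+ 2 * D z).
  apply: (le_integrable2 (g := fun z => C * D z)); last exact: integrable2Z.
    apply: measurable_funM; last exact: mD.
    by apply: measurable_funX; exact: mh.
  move=> z; rewrite ger0_norm; first by apply: ler_wpM2r => //; exact: D0.
  by apply: mulr_ge0; [exact: sqr_ge0|exact: D0].
move=> hi; exact (@integrable_lty _ _ _ (leb2 R) setT measurableT _ hi).
Qed.

Let f_sqr_le1 z : f (Some z) ^+ 2 <= 1.
Proof.
rewrite fE exprMn; apply: mulr_ile1; [exact: sqr_ge0|exact: sqr_ge0| |exact: F1].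
by rewrite indicE; case: (_ \in _); rewrite ?expr1n ?expr0n.
Qed.

Let L2f : L2 v f.
Proof. exact: (bounded_L2 (C := 1)). Qed.

Let L2f2 : L2 v (2 *: f).
Proof.
have m2 : measurable_fun setT ((2 *: f) \o Some : plane -> R).
  have -> : (2 *: f) \o Some = fun z => 2 * (f \o Some) z by [].
  by apply: measurable_funM; [exact: measurable_cst|exact: mf].
apply: (bounded_L2 (C := 4)) => // z.
rewrite f2E exprMn -fE expr2; have := f_sqr_le1 z.
by move: (f (Some z) ^+ 2) => x h; lra.
Qed.

Lemma ipE (g h : sphere -> R) :
  L2_ip v g h = integral2 (fun z => g (Some z) * h (Some z) * D z).
Proof. by []. Qed.

(** Conformal invariance in dimension two: the area density cancels the factor of the Laplacian, and
    all pairings become flat integrals. *)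
Let lapE (g : sphere -> R) z : laplacian v g (Some z) * D z =
  - flat_laplacian (fun z => g (Some z)) z.
Proof.
have e x : expR (- (2 * x)) * expR (2 * x) = 1 :> R by rewrite -expRD addNr expR0.
rewrite /laplacian /laplacian_chart -[g \o _]/(fun z => g (Some z)) confE DE.
by rewrite mulNr mulrAC !mulNr e mul1r.
Qed.

Lemma test_function_supported (psi : sphere -> R) : test_functions P psi ->
  smooth_on U (fun z => psi (Some z)) /\ supported U (fun z => psi (Some z)).
Proof.
move=> [sm [K [cK KP K0]]].
have KNone : ~ K None by move=> /KP; apply.
split.
  by have := sm false; rewrite (@chart_preimage _ k s t st0 false).
split.
  have [M HM] := compact_sphere_bounded cK KNone.
  by exists M => z /HM /K0.
move=> z nUz; have nKz : ~ K (Some z) by move=> /KP /PU.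
have := compact_sphere_separated cK KNone nKz.
by apply: filterS => w /K0.
Qed.

Let adjoint_f : adjoint (L2 v) (L2_ip v) (test_functions P) (laplacian v) f (2 *: f).
Proof.
split => // psi /test_function_supported[spsi supp].
have e1 : L2_ip v f (laplacian v psi) =
    integral2 (fun z => F z * - flat_laplacian (fun z => psi (Some z)) z).
  rewrite ipE; congr integral2; apply/funext => z.
  rewrite -mulrA lapE fE.
  have [Uz|nUz] := pselect (U z); first by rewrite (indic_regular Uz) mul1r.
  by rewrite (supported_flat_laplacian0 supp nUz) oppr0 !mulr0.
have e2 : L2_ip v (2 *: f) psi = integral2 (fun z => 2 * F z * psi (Some z) * D z).
  rewrite ipE; congr integral2; apply/funext => z.
  rewrite f2E.
  have [Uz|nUz] := pselect (U z); first by rewrite (indic_regular Uz) mul1r.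
  by rewrite (supported_eq0 supp nUz) !mulr0 !mul0r.
exact: (etrans e1 (etrans (green_eigenfunction oU sF cD lapF spsi supp) (esym e2))).
Qed.

Definition truncated (n : nat) (x : sphere) : R :=
  if x is Some z then F z * cutoff k s t n.+1 z else 0.

Lemma truncated_test n : test_functions P (truncated n).
Proof.
split; last first.
  exists (Some @` cutoff_supp k s t n.+1); split.
  - apply: continuous_compact; last exact: compact_cutoff_supp.
    by apply: continuous_subspaceT; exact: one_point_compactification_some_continuous.
  - by move=> _ [z Kz <-]; apply/PU; exact: cutoff_supp_regular Kz.
  - move=> [z|] //= nK; rewrite cutoff_suppP ?mulr0// => Kz.
    by apply: nK; exists z.
move=> b; rewrite chart_preimage//.
case: b; last by apply: smoothM => //; exact: smooth_cutoff.
have oT : open (regular k t s) by exact: open_regular.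
have inv0 z : regular k t s z -> z != 0.
  exact: (regular_chart_neq0 infinity_point).
have invU z : regular k t s z -> U (z.1 / sqn z, - z.2 / sqn z).
  move=> Uz; have := (chart_regular k st0 true z).2 Uz.
  by rewrite /chart /= (negbTE (inv0 z Uz)) => /PU.
(* The same function written in the chart 1/z: phi keeps its form because [sum_r] is 0, while each
   log distance loses log |z|, which is smooth since regular points avoid the origin. *)
apply: (smooth_ext oT (f := fun z => th (log_comb k t s r z) *
   (expR 1 * bumpR (1 - (\sum_(i < k) (log_dist (t i) (s i) z - 2^-1 * ln (sqn z)) ^+ 2)
      * (n.+1%:R ^+ 2)^-1)))).
  move=> z Uz; have z0 := inv0 z Uz.
  rewrite /= /chart /= (negbTE z0) /= /F (log_comb_inv infinity_point)//.
  rewrite sum_r mulr0 mul0r subr0 /cutoff indic_regular ?mul1r; last exact: invU.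
  congr (_ * (_ * bumpR (_ - _ / _))); apply: eq_bigr => i _.
  have n0 : 0 < sqn z by rewrite lt_def sqn_ge0 sqn_eq0 z0.
  rewrite /log_dist lin_sq_inv// ln_div ?posrE//; first by rewrite -mulrBr.
  by rewrite lin_sq_gt0; exact: Uz.
have ssq : smooth_on (regular k t s) (fun z => ln (sqn z)).
  apply: smooth_ln => //.
    by apply: smoothD => //; apply: smoothX => //; [exact: smooth_fst|exact: smooth_snd].
  by move=> z /inv0 z0; rewrite lt_def sqn_ge0 sqn_eq0 z0.
apply: smoothM => //; first by apply: smooth_th => //; exact: smooth_log_comb.
apply: smoothM => //; first exact: smooth_cst.
apply: smooth_bump => //; apply: smoothB => //; first exact: smooth_cst.
apply: smoothM => //; last exact: smooth_cst.
apply: smooth_sum => // i; apply: smoothX => //; apply: smoothB => //.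
  by apply: smooth_log_dist => // z; exact.
by apply: smoothM => //; exact: smooth_cst.
Qed.

Let err (n : nat) (z : plane) : R := (F z * (cutoff k s t n.+1 z - \1_U z)) ^+ 2 * D z.

Let err_bound n z : `|err n z| <= D z.
Proof.
rewrite ger0_norm; last by apply: mulr_ge0; [exact: sqr_ge0|exact: D0].
rewrite -[leRHS]mul1r ler_wpM2r ?D0// exprMn -[leRHS]mulr1 ler_pM ?sqr_ge0//.
have h0 := cutoff_ge0 k s t n.+1 z; have h1 := cutoff_le k s t n.+1 z.
have h2 : \1_U z <= 1 :> R by rewrite indicE; case: (_ \in _).
by rewrite -real_normK ?num_real// expr_le1// ler_norml; lra.
Qed.

Let mcut n : measurable_fun setT (cutoff k s t n.+1).
Proof.
apply: continuous_measurable_plane; apply: (@supported_continuous _ U).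
  by move=> z Uz; apply: smooth_continuous Uz; exact: smooth_cutoff.
exact: supported_cutoff.
Qed.

Let merr n : measurable_fun setT (err n).
Proof.
apply: measurable_funM; last exact: mD; apply: measurable_funX.
by apply: measurable_funM; [exact: mF|apply: measurable_funB; [exact: mcut|exact: m1U]].
Qed.

Let ierr n : integrable2 (err n).
Proof. by apply: (le_integrable2 (merr n) (err_bound n)); exact: iD. Qed.

Let err_cvg : integral2 (err n) @[n --> \oo] --> (0 : R).
Proof.
apply: (@dominated_Rintegral_cvg0 _ _ _ (leb2 R) err D merr _ iD err_bound) => z.
rewrite /err -[X in _ --> X](mul0r (D z)); apply: cvgM; last exact: cvg_cst.
have h : F z * (cutoff k s t n.+1 z - \1_U z) @[n --> \oo] --> (0 : R).
  rewrite -[X in _ --> X](mulr0 (F z)); apply: cvgM; first exact: cvg_cst.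
  by rewrite -(subrr (\1_U z)); apply: cvgB; [exact: cutoff_cvg|exact: cvg_cst].
rewrite -[X in _ --> X](mulr0 (0 : R)).
rewrite (_ : (fun n => _) = (fun n => (F z * (cutoff k s t n.+1 z - \1_U z)) *
  (F z * (cutoff k s t n.+1 z - \1_U z)))); first exact: cvgM.
by apply/funext => n; rewrite expr2.
Qed.

Let truncated_cvg : hnorm (L2_ip v) (truncated n - f) @[n --> \oo] --> (0 : R).
Proof.
have e n : L2_ip v (truncated n - f) (truncated n - f) = integral2 (err n).
  rewrite ipE; congr integral2; apply/funext => z.
  have E : (truncated n - f) (Some z) = F z * cutoff k s t n.+1 z - \1_U z * F z by [].
  rewrite E.
  by rewrite /err (mulrC (\1_U z)) -mulrBr expr2.
rewrite /hnorm -[X in _ --> X]sqrtr0.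
under eq_cvg do rewrite e.
apply: (@continuous_cvg _ _ _ _ _ _ (@Num.sqrt R)); last exact: err_cvg.
exact: sqrt_continuous.
Qed.

(** |grad chi|^2 is at most twice the sum of the squared gradients of the two cutoffs, each with two
    components under [energy_bound]; moreover F^2 <= 1. *)
Let cutoff_energy m' n :
  let chi z := cutoff k s t m'.+1 z - cutoff k s t n.+1 z in
  forall z, F z ^+ 2 * grad_dot chi chi z <=
    4 * energy_bound k s t m'.+1 z + 4 * energy_bound k s t n.+1 z.
Proof.
move=> chi z.
have sup (l : nat) : supported U (cutoff k s t l.+1) by exact: supported_cutoff.
have dc (l : nat) : differentiable (cutoff k s t l.+1) z.
  by apply: (@supported_differentiable _ U); [exact: smooth_cutoff|exact: sup].
have pchi i : partial i chi z =
    partial i (cutoff k s t m'.+1) z - partial i (cutoff k s t n.+1) z.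
  exact: (partialB i (dc m') (dc n)).
have bd l i : partial i (cutoff k s t l.+1) z ^+ 2 <= energy_bound k s t l.+1 z.
  exact: partial_cutoff_bound.
have E0 l : 0 <= energy_bound k s t l.+1 z by apply: le_trans (bd l true); exact: sqr_ge0.
rewrite /grad_dot (pchi false) (pchi true).
have := bd m' false; have := bd m' true; have := bd n false; have := bd n true.
have := F1 z; have := sqr_ge0 (F z).
move: (partial false (cutoff k s t m'.+1) z) (partial true (cutoff k s t m'.+1) z)
  (partial false (cutoff k s t n.+1) z) (partial true (cutoff k s t n.+1) z)
  (energy_bound k s t m'.+1 z) (energy_bound k s t n.+1 z) (F z ^+ 2).
move=> a b a' b' E E' f2 f0 f1 h1 h2 h3 h4.
apply: (@le_trans _ _ (1 * ((a - a') * (a - a') + (b - b') * (b - b')))).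
  by apply: ler_wpM2r => //; rewrite -!expr2 addr_ge0// sqr_ge0.
have := sqr_ge0 (a + a'); have := sqr_ge0 (b + b'); lra.
Qed.

(** The difference of two truncations is F chi, so its energy is an L^2 term, controlled by the
    convergence to the eigenfunction, plus F^2 |grad chi|^2, controlled by the cutoff energies. *)
Let truncated_cauchy (e : R) : 0 < e -> exists N : nat, forall m' n : nat,
  (N <= m')%N -> (N <= n)%N ->
  L2_ip v (laplacian v (truncated m' - truncated n)) (truncated m' - truncated n) < e.
Proof.
move=> e0; have [C HC] := integral_energy_bound k s t.
(* Four error terms enter below, each with coefficient 4. *)
have e16 : 0 < e / 16 by rewrite divr_gt0.
have hC : C / n.+1%:R @[n --> \oo] --> (0 : R).
  by rewrite -[X in _ --> X](mulr0 C); apply: cvgM; [exact: cvg_cst|exact: cvg_harmonic].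
have /cvgr_lt /(_ _ e16) n1 := hC.
have /cvgr_lt /(_ _ e16) n2 := err_cvg.
have [N _ HN] : \forall n \near \oo, C / n.+1%:R < e / 16 /\ integral2 (err n) < e / 16.
  by apply: filterS2 n1 n2.
exists N => m' n Nm Nn.
have [m1 m2] := HN m' Nm; have [n1' n2'] := HN n Nn.
pose chi z := cutoff k s t m'.+1 z - cutoff k s t n.+1 z.
have schi : smooth_on U chi by apply: smoothB => //; exact: smooth_cutoff.
have supchi : supported U chi by apply: supportedB; exact: supported_cutoff.
have [i1 i2 e1] := energy_eigenfunction oU sF cD lapF schi supchi.
have -> : L2_ip v (laplacian v (truncated m' - truncated n)) (truncated m' - truncated n) =
    integral2 (fun z => - flat_laplacian (fun x => F x * chi x) z * (F z * chi z)).
  rewrite ipE; congr integral2; apply/funext => z.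
  have E x : (truncated m' - truncated n) (Some x) = F x * chi x.
    by rewrite /chi mulrBr.
  have Ef : (fun x => (truncated m' - truncated n) (Some x)) = fun x => F x * chi x.
    by apply/funext => x; exact: E.
  by rewrite mulrAC lapE Ef E.
rewrite e1.
have ie (l : nat) := integrable_energy_bound k s t l.+1.
have b2 : integral2 (fun z => F z ^+ 2 * grad_dot chi chi z) <=
    4 * integral2 (energy_bound k s t m'.+1) + 4 * integral2 (energy_bound k s t n.+1).
  have i3 := integrable2D (integrable2Z 4 (ie m')) (integrable2Z 4 (ie n)).
  apply: (le_trans (le_integral2 i2 i3 (cutoff_energy m' n))).
  have E := integral2D (integrable2Z 4 (ie m')) (integrable2Z 4 (ie n)).
  have E2 := congr2 +%R (integral2Z 4 (ie m')) (integral2Z 4 (ie n)).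
  by rewrite (etrans E E2).
have b1 : integral2 (fun z => 2 * (F z * chi z) ^+ 2 * D z) <=
    4 * integral2 (err m') + 4 * integral2 (err n).
  have i3 := integrable2D (integrable2Z 4 (ierr m')) (integrable2Z 4 (ierr n)).
  have E := integral2D (integrable2Z 4 (ierr m')) (integrable2Z 4 (ierr n)).
  have E2 := congr2 +%R (integral2Z 4 (ierr m')) (integral2Z 4 (ierr n)).
  apply: (@le_trans _ _ (integral2 (fun z => 4 * err m' z + 4 * err n z))); last first.
    by rewrite (etrans E E2).
  apply: (le_integral2 i1 i3) => z; rewrite /err.
  have -> : F z * chi z = F z * (cutoff k s t m'.+1 z - \1_U z) -
      F z * (cutoff k s t n.+1 z - \1_U z) by rewrite /chi; ring.
  exact/weighted_sqr_sub_le/D0.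
have c1 := le_lt_trans (HC m'.+1 isT) m1; have c2 := le_lt_trans (HC n.+1 isT) n1'.
exact (le_lt_trans (lerD b1 b2) (sixteenths_lt m2 n2' c1 c2)).
Qed.

Let form_domain_f : form_domain (L2 v) (L2_ip v) (test_functions P) (laplacian v) f.
Proof.
split => //; exists truncated; split.
- exact: truncated_test.
- exact: truncated_cvg.
- exact: truncated_cauchy.
Qed.

Let exists_nonzero : exists2 z, U z & F z != 0.
Proof.
(* The point i lies off the real axis, hence is regular. If F vanished on [U], so would phi and its
   gradient, against the positive right side of [gradE]. *)
pose z1 : plane := (0, 1).
have U1 : U z1.
  move=> i; rewrite lin_sq_eq0 /= mulr0 mulr1 negb_and eq_sym.
  have [si|si] := eqVneq (s i) 0; last by rewrite orbT.
  by rewrite (st0 si).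
apply: contrapT => h.
have F0 z : U z -> log_comb k s t r z = 0.
  move=> Uz; apply/eqP; rewrite -th_eq0; apply: contrapT => /negP Fz.
  by apply: h; exists z.
have p0 i : partial i (log_comb k s t r) z1 = 0.
  rewrite (near_partial (g := fun=> 0)) ?partial_cst//.
  exact: open_near oU _ _ _ U1 F0.
have := gradE U1; rewrite /grad_dot (p0 false) (p0 true) !mulr0 addr0 => /esym/eqP.
by rewrite gt_eqF// mulr_gt0 ?expR_gt0// exprn_gt0.
Qed.

(** By continuity F^2 D exceeds half its value at a point with F nonzero on a small square, whose
    area bounds the integral from below. *)
Let ip_f_gt0 : 0 < L2_ip v f f.
Proof.
have [z1 U1 F1'] := exists_nonzero.
pose g z := F z ^+ 2 * D z.
have g1 : 0 < g z1.
  by rewrite mulr_gt0 ?expR_gt0// lt_def sqr_ge0 sqrf_eq0 F1'.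
have cg : {for z1, continuous g}.
  apply: cvgM; last exact: cD.
  rewrite (_ : (fun z => F z ^+ 2) = fun z => F z * F z); last first.
    by apply/funext => z; rewrite expr2.
  by rewrite expr2; apply: cvgM; exact: (smooth_continuous sF U1).
have /cvgr_gt /(_ (g z1 / 2)) := cg.
rewrite ltr_pdivrMr// ltr_pMr// ltr1n => /(_ isT) n1.
have n2 : \forall z \near z1, U z by apply: open_nbhs_nbhs; split; [exact: oU|exact: U1].
have /nbhs_ballP[d /= d0 Hd] : \forall z \near z1, U z /\ g z1 / 2 < g z.
  by apply: filterS2 n2 n1.
have d2 : 0 <= d / 2 by rewrite divr_ge0// ltW.
pose Q := square z1.1 z1.2 (d / 2).
have QP z : Q z -> U z /\ g z1 / 2 < g z.
  move=> [/=]; rewrite !in_itv /= -!ler_distl => h1 h2; apply: Hd.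
  have dd : d / 2 < d by rewrite ltr_pdivrMr// ltr_pMr// ltr1n.
  by split; rewrite /ball /= distrC (le_lt_trans _ dd).
have mff : measurable_fun setT (fun z => f (Some z) * f (Some z) * D z).
  by apply: measurable_funM; [apply: measurable_funM; exact: mf|exact: mD].
have iff : integrable2 (fun z => f (Some z) * f (Some z) * D z).
  apply: (le_integrable2 mff _ iD) => z.
  rewrite -expr2 ger0_norm; last by apply: mulr_ge0; [exact: sqr_ge0|exact: D0].
  by rewrite -[leRHS]mul1r; apply: ler_wpM2r; [exact: D0|exact: f_sqr_le1].
have iQ := integrable2_square z1.1 z1.2 (g z1 / 2) d2.
rewrite ipE; apply: (@lt_le_trans _ _ (g z1 / 2 * (4 * (d / 2) ^+ 2))).
  apply: mulr_gt0; first by rewrite divr_gt0.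
  by apply: mulr_gt0 => //; apply: exprn_gt0; rewrite divr_gt0.
rewrite -(integral2_square z1.1 z1.2 (g z1 / 2) d2); apply: le_integral2 => // z.
rewrite indicE; case: (boolP (z \in square z1.1 z1.2 (d / 2))) => [|_]; last first.
  by rewrite mulr0 -expr2 mulr_ge0 ?sqr_ge0// D0.
rewrite inE => /QP[Uz gz]; rewrite mulr1 fE (indic_regular Uz) mul1r -expr2.
exact: ltW.
Qed.

(** An eigenfunction of positive norm violates the resolvent bound, whose right side is then C times
    the norm of 0. *)
Theorem two_in_spectrum : laplace_spectrum P v 2.
Proof.
move=> [_ [C HC]].
have fr : friedrichs (L2 v) (L2_ip v) (test_functions P) (laplacian v) f (2 *: f).
  by split.
have := HC _ _ fr; rewrite subrr.
have -> : hnorm (L2_ip v) (0 : sphere -> R) = 0.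
  rewrite /hnorm ipE (_ : (fun z => _) = fun z => 0 * \1_(square 0 0 0) z); last first.
    apply/funext => z; have E : (0 : sphere -> R) (Some z) = 0 by [].
    by rewrite E !mul0r.
  by rewrite integral2_square// mul0r sqrtr0.
by rewrite mulr0 leNgt /hnorm sqrtr_gt0 ip_f_gt0.
Qed.

End spectrum.

(** * The examples *)

Section axis_metric.
Context {R : realType}.
Local Notation plane := (R * R)%type.
Local Notation sphere := (sphere R).
Variables (k : nat) (a r m : nat -> R) (c : R).

(* Homogeneous coordinates of the points oo, a 1, a 2, a 3, and so on. *)
Definition axis_s (i : nat) : R := if i is 0 then 0 else 1.
Definition axis_t (i : nat) : R := if i is 0 then 1 else a i.

Lemma sphere_metric_two : (1 < k)%N ->
  (forall i j, (0 < i < k)%N -> (0 < j < k)%N -> a i = a j -> i = j) ->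
  \sum_(i < k) r i = 0 -> \sum_(i < k) m i = - 2 ->
  (forall i : 'I_k, 0 <= m i + `|r i|) -> 0 < c ->
  (forall b z, regular k (chart_s axis_s axis_t b) (chart_t axis_s axis_t b) z ->
    let phi := log_comb k (chart_s axis_s axis_t b) (chart_t axis_s axis_t b) r in
    grad_dot phi phi z = c ^+ 2 *
      expR (2 * log_comb k (chart_s axis_s axis_t b) (chart_t axis_s axis_t b) m z)) ->
  exists (p : 'I_k -> sphere) (v : sphere -> R),
    spherical_cone_metric (\row_i (1 + (m i + `|r i|))) p v /\
    laplace_spectrum (range p) v 2.
Proof.
move=> k1 ainj sum_r sum_m mr c0 gradE.
have st0 i : axis_s i = 0 -> axis_t i != 0.
  by case: i => [|i] /=; [rewrite oner_neq0|move/eqP; rewrite oner_eq0].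
have inf : exists i : 'I_k, axis_s i = 0 by exists (Ordinal (ltnW k1)).
have fin : exists i : 'I_k, axis_s i != 0 by exists (Ordinal k1); rewrite /= oner_neq0.
have pinj : injective (axis_points (k := k) axis_s axis_t).
  move=> [[|i] ik] [[|j] jk]; rewrite /axis_points /axis_point /= ?eqxx ?oner_eq0 //.
  - by move=> _; exact: val_inj.
  - by rewrite !divr1 => -[/ainj ij]; apply: val_inj; exact: ij.
exists (axis_points axis_s axis_t), (cone_exp k axis_s axis_t r m c); split.
  split => //.
  - by move=> i; rewrite mxE ltr_wpDr.
  - exact: smooth_cone_exp.
  - by move=> b z; exact: gauss_curvature_cone.
  - by move=> i; rewrite mxE; exact: conic_cone.
exact: (two_in_spectrum st0 inf fin pinj sum_r sum_m mr c0 (gradE false)).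
Qed.

Lemma sum_head (n : nat) (g : nat -> R) : (n <= k)%N ->
  (forall i, (n <= i)%N -> g i = 0) -> \sum_(i < k) g i = \sum_(i < n) g i.
Proof.
move=> nk g0; rewrite -(subnKC nk) big_split_ord /= [X in _ + X]big1 ?addr0// => i _.
by rewrite g0// leq_addr.
Qed.

Lemma log_comb_head (n : nat) (s t w : nat -> R) : (n <= k)%N ->
  (forall i, (n <= i)%N -> w i = 0) -> log_comb k s t w = log_comb n s t w.
Proof.
move=> nk w0; apply/funext => z; rewrite /log_comb.
rewrite (sum_head (g := fun i => w i * log_dist (s i) (t i) z) nk)// => i ni.
by rewrite w0// mul0r.
Qed.

(* Points with [r i = m i = 0] are marked smooth points of cone angle 2 pi. *)
Lemma sphere_metric_head (n : nat) : (n <= k)%N -> (1 < n)%N ->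
  (forall i j, (0 < i < k)%N -> (0 < j < k)%N -> a i = a j -> i = j) ->
  (forall i, (n <= i)%N -> r i = 0) -> (forall i, (n <= i)%N -> m i = 0) ->
  \sum_(i < n) r i = 0 -> \sum_(i < n) m i = - 2 ->
  (forall i, (i < n)%N -> 0 <= m i + `|r i|) -> 0 < c ->
  (forall b z, regular n (chart_s axis_s axis_t b) (chart_t axis_s axis_t b) z ->
    let phi := log_comb n (chart_s axis_s axis_t b) (chart_t axis_s axis_t b) r in
    grad_dot phi phi z = c ^+ 2 *
      expR (2 * log_comb n (chart_s axis_s axis_t b) (chart_t axis_s axis_t b) m z)) ->
  exists (p : 'I_k -> sphere) (v : sphere -> R),
    spherical_cone_metric (\row_i (1 + (m i + `|r i|))) p v /\
    laplace_spectrum (range p) v 2.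
Proof.
move=> nk n1 ainj r0 m0 sum_r sum_m mr c0 gradE.
apply: sphere_metric_two => //.
- exact: leq_trans nk.
- by rewrite (sum_head nk r0).
- by rewrite (sum_head nk m0).
- move=> i; have [ni|ni] := leqP n i; last exact: mr.
  by rewrite r0// m0// normr0 addr0.
move=> b z Uz; rewrite !(log_comb_head _ _ nk)//; apply: gradE => i.
exact: (Uz (widen_ord nk i)).
Qed.

End axis_metric.

Section examples.
Context {R : realType}.
Local Notation plane := (R * R)%type.
Local Notation sphere := (sphere R).

(* omega = d dz / z, with simple poles at oo and 0. *)
Definition football_r (d : R) (i : nat) : R :=
  match i with 0 => - d | 1 => d | _ => 0 end.

Definition football_m (i : nat) : R := if (i < 2)%N then -1 else 0.

(** Index 1 is the pole 0, later indices are the positive integers; the entry at index 0 is a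
    default, that point being oo. *)
Definition football_a (i : nat) : R := i.-1%:R.

Lemma football_metric (k : nat) (d : R) : (1 < k)%N -> 1 <= d ->
  exists (p : 'I_k -> sphere) (v : sphere -> R),
    spherical_cone_metric (\row_i (1 + (football_m i + `|football_r d i|))) p v /\
    laplace_spectrum (range p) v 2.
Proof.
move=> k1 d1; have d0 : 0 < d by exact: lt_le_trans d1.
apply: (@sphere_metric_head R k football_a _ _ d 2) => //.
- by move=> [|i] [|j]//= _ _ /eqP; rewrite /football_a eqr_nat /= => /eqP ->.
- by case=> [|[|i]].
- by move=> i; rewrite /football_m leqNgt => /negbTE ->.
- by rewrite !big_ord_recr big_ord0 /=; ring.
- by rewrite !big_ord_recr big_ord0 /football_m /=; ring.
- by case=> [|[|i]]//= _; rewrite /football_m /= ?normrN gtr0_norm// addrC subr_ge0.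
move=> b z Uz phi; have := Uz ord0; have := Uz ord_max.
rewrite /grad_dot /phi !partial_log_comb// /log_comb.
rewrite !big_ord_recr !big_ord0 /football_m /= /log_dist.
have e1 : lin_sq 0 1 z = 1 by rewrite /lin_sq; ring.
have eE q : 0 < q -> expR (- ln q) = q^-1 :> R by move=> q0; rewrite expRN lnK.
have E : lin_sq 1 0 z != 0 -> expR (- ln (lin_sq 1 0 z)) = (z.1 ^+ 2 + z.2 ^+ 2)^-1.
  by rewrite -lin_sq_gt0 => /eE ->; congr (_^-1); rewrite /lin_sq; ring.
have E' : lin_sq 1 0 z = z.1 ^+ 2 + z.2 ^+ 2 by rewrite /lin_sq; ring.
case: b {Uz phi} => /=; rewrite /football_a /= e1 ln1.
- move=> _ q0; rewrite [X in expR X](_ : _ = - ln (lin_sq 1 0 z)); last by field.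
  rewrite E//; move: q0; rewrite E'; move: z.1 z.2 => x y q0; field.
  by [].
- move=> q0 _; rewrite [X in expR X](_ : _ = - ln (lin_sq 1 0 z)); last by field.
  rewrite E//; move: q0; rewrite E'; move: z.1 z.2 => x y q0; field.
  by [].
Qed.

(* omega = 48 d dz / ((z^2 - 1) (z^2 - 9)), with a double zero at oo. *)
Definition quad_r (d : R) (i : nat) : R :=
  match i with 1 => - (3 * d) | 2 => 3 * d | 3 => d | 4 => - d | _ => 0 end.

Definition quad_m (i : nat) : R := if i is 0 then 2 else if (i < 5)%N then -1 else 0.

(** From index 5 on the points lie beyond 3, away from the four poles; the entry at index 0 is a
    default. *)
Definition quad_a (i : nat) : R :=
  match i with 1 => 1 | 2 => -1 | 3 => 3 | 4 => -3 | _ => i%:R end.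

Lemma quad_a_inj i j : (0 < i)%N -> (0 < j)%N -> quad_a i = quad_a j -> i = j.
Proof.
have big (n : nat) : quad_a n.+4.+1 = 5 + n%:R by rewrite /= -[n.+4.+1]/(5 + n)%N natrD.
have neq (x : R) n : x < 5 -> 5 + n%:R <> x.
  by move=> x5 e; have := ler0n R n; lra.
case: i => [//|[|[|[|[|i]]]]] _; case: j => [//|[|[|[|[|j]]]]] _;
  rewrite ?big // => e; try (by exfalso; move: e => /=; lra);
  try (by exfalso; apply: neq e => /=; lra); try (by exfalso; apply: neq (esym e) => /=; lra).
by move/addrI/eqP: e; rewrite eqr_nat => /eqP ->.
Qed.

(** Minus the logarithm of |omega|^2 up to a constant, q_i being the squared distances: weight 2 at
    index 0 and -1 at the poles. *)
Definition ln_sum_quad (q0 q1 q2 q3 q4 : R) : R :=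
  ln q1 + ln q2 + ln q3 + ln q4 - ln q0 - ln q0.

Lemma expR_ln_sum_quad (q0 q1 q2 q3 q4 : R) :
  0 < q0 -> 0 < q1 -> 0 < q2 -> 0 < q3 -> 0 < q4 ->
  expR (- ln_sum_quad q0 q1 q2 q3 q4) = q0 ^+ 2 / (q1 * q2 * q3 * q4).
Proof.
move=> h0 h1 h2 h3 h4; rewrite /ln_sum_quad expRN !expRD !expRN !lnK ?posrE//.
by field; rewrite !gt_eqF.
Qed.

(** Partial fractions: the residues sum to - 6 d / (z^2 - 1) + 6 d / (z^2 - 9), which is omega / dz;
    this is where 48 = 6 (9 - 1) comes from. The gradient condition is the squared modulus of this
    identity in each chart. *)
Lemma quad_metric (k : nat) (d : R) : (4 < k)%N -> 1 <= d ->
  exists (p : 'I_k -> sphere) (v : sphere -> R),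
    spherical_cone_metric (\row_i (1 + (quad_m i + `|quad_r d i|))) p v /\
    laplace_spectrum (range p) v 2.
Proof.
move=> k1 d1; have d0 : 0 < d by exact: lt_le_trans d1.
apply: (@sphere_metric_head R k quad_a _ _ (48 * d) 5) => //.
- by move=> i j /andP[i0 _] /andP[j0 _]; exact: quad_a_inj.
- by case=> [|[|[|[|[|i]]]]].
- by case=> [|[|[|[|[|i]]]]].
- by rewrite !big_ord_recr big_ord0 /=; ring.
- by rewrite !big_ord_recr big_ord0 /quad_m /=; ring.
- case=> [|[|[|[|[|i]]]]]//= _; rewrite /quad_m /= ?normrN ?normr0 ?gtr0_norm ?mulr_gt0//;
  lra.
- by rewrite mulr_gt0.
move=> b z Uz phi; have q0 := Uz ord0; have q1 := Uz (inord 1).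
have q2 := Uz (inord 2); have q3 := Uz (inord 3); have q4 := Uz (inord 4).
move: q0 q1 q2 q3 q4; rewrite !inordK//.
rewrite /grad_dot /phi !partial_log_comb// /log_comb.
rewrite !big_ord_recr !big_ord0 /quad_m /= /log_dist.
rewrite -!lin_sq_gt0 => p0 p1 p2 p3 p4.
rewrite [X in expR X](_ : _ = - (ln_sum_quad (lin_sq (chart_s axis_s (axis_t quad_a) b 0)
            (chart_t axis_s (axis_t quad_a) b 0) z) (lin_sq (chart_s axis_s (axis_t quad_a) b 1)
            (chart_t axis_s (axis_t quad_a) b 1) z) (lin_sq (chart_s axis_s (axis_t quad_a) b 2)
            (chart_t axis_s (axis_t quad_a) b 2) z) (lin_sq (chart_s axis_s (axis_t quad_a) b 3)
            (chart_t axis_s (axis_t quad_a) b 3) z) (lin_sq (chart_s axis_s (axis_t quad_a) b 4)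
            (chart_t axis_s (axis_t quad_a) b 4) z))); last by rewrite /ln_sum_quad; field.
rewrite expR_ln_sum_quad// {Uz phi}.
case: b p0 p1 p2 p3 p4; rewrite /chart_s /chart_t /axis_s /axis_t /quad_a /lin_sq;
  move: z.1 z.2 => x y /lt0r_neq0 p0 /lt0r_neq0 p1 /lt0r_neq0 p2 /lt0r_neq0 p3 /lt0r_neq0 p4.
- rewrite !mul1r subr0 in p0; rewrite !mul1r in p1.
  by field; rewrite p4 p3 p2 p1 p0.
- rewrite !mul1r ?opprK in p1 p2 p3 p4.
  by field; rewrite p4 p3 p2 p1.
Qed.

(** * Position relative to the Mondello-Panov region *)

Lemma half_int_norm (z : int) : 2^-1 <= `|z%:~R + 2^-1| :> R.
Proof.
have [z0|z0] := leP 0 z.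
  have : 0 <= z%:~R :> R by rewrite ler0z.
  by move=> h; rewrite ger0_norm; lra.
have : z%:~R <= -1 :> R by rewrite -[-1]/((-1)%:~R) ler_int -ltzD1.
by move=> h; rewrite ler0_norm; lra.
Qed.

(** At the four poles beta - 1 is half an odd integer, so at least 1/2 from any integer. A move of
    less than 1/4 per coordinate leaves at least 1/4 at each, and four quarters make 1. *)
Lemma quad_MP_interior (n k : nat) : (4 < k)%N -> (0 < n)%N ->
  interior (@MP R k) (\row_i (1 + (quad_m i + `|quad_r (n%:R + 2^-1) i|))).
Proof.
move=> k4 n0; set beta := (X in interior _ X); set d : R := n%:R + 2^-1.
have dge1 : 1 <= d.
  have h : 1 <= n%:R :> R by rewrite ler1n.
  by rewrite /d; lra.
have d0 : 0 < d by exact: lt_le_trans dge1.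
have b1 i : 1 <= beta 0 i.
  rewrite mxE -/d lerDl; case: (nat_of_ord i) => [|[|[|[|[|j]]]]];
    by rewrite /quad_m /= ?normrN ?normr0 ?gtr0_norm ?mulr_gt0//; lra.
apply/nbhs_ballP; exists 4^-1 => /=; first by rewrite invr_gt0.
move=> x [_ bx]; have {}bx i : `|beta 0 i - x 0 i| < 4^-1 by exact: bx.
split=> [i|].
  have := bx i; have := b1 i; rewrite ltr_norml => h1 /andP[_ h2].
  by have : (4^-1 : R) < 1; lra.
apply: lb_le_inf.
  (* The infimum must be over a nonempty set; the first unit vector has coordinate sum 1. *)
  exists (d1 (x - const_mx 1) (map_mx intr (\row_(i < k) ((i : nat) == 0%N)%:R)));
    exists (map_mx intr (\row_(i < k) ((i : nat) == 0%N)%:R)) => //.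
  exists (\row_(i < k) ((i : nat) == 0%N)%:R) => //; exists 0; rewrite mulr0 add0r.
  rewrite (bigD1 (Ordinal (ltn_trans (isT : 0 < 4)%N k4)))//= mxE eqxx big1 ?addr0//.
  by move=> i i0; rewrite mxE; case: eqP => // e; case/eqP: i0; exact: val_inj.
move=> _ [_ [g _ <-] <-]; rewrite /d1.
have key (i : 'I_k) : (0 < i < 5)%N ->
    4^-1 <= `|(x - const_mx 1) 0 i - (map_mx intr g : 'rV[R]_k) 0 i|.
  move=> i05; rewrite !mxE.
  have [z hz] : exists z : int, beta 0 i - 1 - (g 0 i)%:~R = z%:~R + 2^-1.
    rewrite mxE -/d; case: (nat_of_ord i) i05 => [|[|[|[|[|j]]]]]// _;
      rewrite /quad_m /= ?normrN ?gtr0_norm ?mulr_gt0// /d.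
    - by exists (3 * n%:Z - g 0 i); rewrite intrB intrM; field.
    - by exists (3 * n%:Z - g 0 i); rewrite intrB intrM; field.
    - by exists (n%:Z - 1 - g 0 i); rewrite !intrB; field.
    - by exists (n%:Z - 1 - g 0 i); rewrite !intrB; field.
  have := half_int_norm z; rewrite -hz => h; have := bx i.
  have := ler_normD (x 0 i - 1 - (g 0 i)%:~R) (beta 0 i - x 0 i).
  rewrite (_ : _ + _ + _ = beta 0 i - 1 - (g 0 i)%:~R); last by ring.
  lra.
pose G (i : 'I_k) := `|(x - const_mx 1) 0 i - (map_mx intr g : 'rV[R]_k) 0 i|.
have G0 i : 0 <= G i by exact: normr_ge0.
apply: (@le_trans _ _ (\sum_(i < k | (0 < i < 5)%N) G i)); last first.
  by rewrite [leRHS](bigID (fun i : 'I_k => (0 < i < 5)%N)) /= lerDl sumr_ge0.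
apply: (@le_trans _ _ (\sum_(i < k | (0 < i < 5)%N) 4^-1)); last exact: ler_sum.
rewrite big_mkcond /= (sum_head (g := fun i => if (0 < i < 5)%N then 4^-1 else 0) k4).
  by rewrite !big_ord_recr big_ord0 /=; lra.
by move=> i i5; rewrite (ltnNge i) i5 andbF.
Qed.

Lemma unbounded_row (k : nat) (B : set 'rV[R]_k) (i : 'I_k) : bounded_set B ->
  exists M : R, forall beta : 'rV[R]_k, M < beta 0 i -> ~ B beta.
Proof.
move=> [M [_ HM]]; exists (M + 1) => beta Mb /(HM (M + 1)) /=.
rewrite ltrDl ltr01 => /(_ isT) h.
have : `|beta 0 i| <= `|beta|.
  have /mapP[j Hj ->] : `|beta 0 i| \in [seq `|beta x.1 x.2| | x : 'I_1 * 'I_k].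
    by apply/mapP; exists (ord0, i) => //=; rewrite mem_enum.
  by rewrite [leRHS]/Num.norm /= mx_normrE; apply/bigmax_geP; right => /=; exists j.
move=> /le_trans /(_ h); rewrite leNgt => /negP; apply.
by rewrite (lt_le_trans Mb)// ler_norm.
Qed.

End examples.

Theorem proposition4 (R : realType) (k : nat) (hk : (2 <= k)%N)
    (B : set 'rV[R]_k) (hB : bounded_set B) (hBMP : B `<=` @MP R k) :
  (exists (beta : 'rV[R]_k) (p : 'I_k -> sphere R) (v : sphere R -> R),
    [/\ spherical_cone_metric beta p v, ~ B beta &
        laplace_spectrum (range p) v 2]) /\
  ((5 <= k)%N ->
   exists (beta : 'rV[R]_k) (p : 'I_k -> sphere R) (v : sphere R -> R),
    [/\ spherical_cone_metric beta p v, ~ B beta,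
        interior (@MP R k) beta &
        laplace_spectrum (range p) v 2]).
Proof.
(* [Ordinal hk] is index 1, a pole in both families, with parameter d for the football and 3 d for
   the other. *)
have [M HM] := unbounded_row (Ordinal hk) hB; split=> [|k5].
  pose d : R := Num.max 1 (M + 1).
  have d1 : 1 <= d by rewrite le_max lexx.
  have [p [v [cone spec]]] := football_metric hk d1.
  exists (\row_i (1 + (football_m i + `|football_r d i|))), p, v; split => //.
  apply: HM; rewrite mxE /football_m /= gtr0_norm ?(lt_le_trans ltr01)//.
  rewrite addrA subrr add0r.
  by apply: (@lt_le_trans _ _ (M + 1)); rewrite ?ltrDl// /d le_max lexx orbT.
(* Positive and larger than [M], whatever the sign of [M]; adding 1/2 makes [d] half an odd
   integer. *)
pose n := (Num.truncn M).+1.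
have nM : M < n%:R :> R by rewrite real_truncnS_gt// num_real.
pose d : R := n%:R + 2^-1.
have d1 : 1 <= d.
  have : 1 <= n%:R :> R by rewrite ler1n.
  by rewrite /d; lra.
have dM : M < d by rewrite (lt_trans nM)// ltrDl invr_gt0.
have [p [v [cone spec]]] := quad_metric k5 d1.
exists (\row_i (1 + (quad_m i + `|quad_r d i|))), p, v; split => //.
  apply: HM; rewrite mxE /quad_m /= normrN gtr0_norm; first by lra.
  by rewrite mulr_gt0// (lt_le_trans ltr01).
exact: quad_MP_interior.
Qed.
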